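(* For all positive integers $t,\delta$ there exists a positive integer $j=j(t,\delta)$ with the following property (one may take $j(t,\delta)=\binom{\delta}{2}R(t,3)$). Let $G$ be a (theta, prism)-free graph with no clique of cardinality $t$, let $a\in V(G)$, let $T$ be a smooth tree of maximum degree $\delta$, and let $\zeta$ be a rich $(T,a)$-strip-structure in $G$. Then for every vertex $v\in V(T)$ we have $|\mathcal{J}_{\zeta,v}|<j$.
   Context: Graphs finite simple; ''path'' = induced path. $R(p,q)$ denotes the Ramsey number: least $n$ such that every graph on at least $n$ vertices has a clique of size $p$ or a stable set of size $q$. Theta: two non-adjacent vertices joined by three internally disjoint paths of length $\ge2$ with pairwise anticomplete interiors. Prism: two disjoint triangles $\{a_1,a_2,a_3\},\{b_1,b_2,b_3\}$, disjoint paths $P_i$ from $a_i$ to $b_i$, with $a_ia_j,b_ib_j$ the only edges between $P_i,P_j$. Pyramid: apex $a$, base triangle $\{b_1,b_2,b_3\}$, paths $P_i$ from $a$ to $b_i$ of length $\ge1$, otherwise disjoint, $b_ib_j$ the only edge between $P_i\setminus\{a\}$, $P_j\setminus\{a\}$, at most one $P_i$ of length one. A vertex $p\notin\Sigma$ is a jewel for pyramid $\Sigma$ at $b_i$ if $p$ is anticomplete to $P_i$ and $N_{P_j}(p)=N_{P_j}[b_j]$ for $j\ne i$. A tree is smooth if it has $\ge3$ vertices and each vertex is a leaf or has degree $>2$. For $\zeta: V(T)\cup E(T)\cup(E(T)\times V(T))\to 2^{V(G)\setminus\{a\}}$, $S\subseteq V(T)$: $\zeta(S)=\bigcup_{v\in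 S}\zeta(v)\cup\bigcup_{e\in E(T[S])}\zeta(e)$, $\zeta(T)=\zeta(V(T))$, $\zeta^+(T)=\zeta(T)\cup\{a\}$, $B(v)=\bigcup_{e\ni v}\zeta(e,v)$, $\zeta^\circ(e)=\zeta(e)\setminus(\zeta(e,u)\cup\zeta(e,v))$ for $e=uv$. $\zeta$ is a $(T,a)$-strip-structure if (S1) the sets $\zeta(o)$, $o\in V(T)\cup E(T)$, are pairwise disjoint; (S2) $\zeta(l)=\emptyset$ for leaves; (S3) $\zeta(e,v)\subseteq\zeta(e)$, nonempty iff $e$ incident with $v$; (S4) for distinct $e,f$ and every $v$, $\zeta(e,v)$ complete to $\zeta(f,v)$, no other edges between $\zeta(e),\zeta(f)$; (S5) for $e=uv$, every $x\in\zeta(e)$ has a path in $G[\zeta(e)]$ to $\zeta(e,u)$ with interior in $\zeta^\circ(e)$, and likewise to $\zeta(e,v)$; (S6) $\zeta(v)$ anticomplete to $\zeta(e)\setminus\zeta(e,v)$; (S7) every component of $G[\zeta(v)]$ has a neighbor in $B(v)$; (S8) for each leaf $l$ with edge $e$, $a$ complete to $\zeta(e,l)$, no other neighbors of $a$ in $\zeta(T)$. A $\zeta(e)$-rung ($e=uv$) is a path $P$ in $G[\zeta(e)]$ with either $|P|=1$, $P\subseteq\zeta(e,u)\cap\zeta(e,v)$, or an end in $\zeta(e,u)\setminus\zeta(e,v)$, an end in $\zeta(e,v)\setminus\zeta(e,u)$, interior in $\zeta^\circ(e)$; long if $|P|\ge2$. $\zeta$ is rich if $a$ is trapped in $\zeta^+(T)$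 (all vertices at distance $\le2$ from $a$ lie in $\zeta^+(T)$, every neighbor of $a$ has degree two in $G[\zeta^+(T)]$) and $|\zeta(e,l)|=1$ for each leaf $l$ with edge $e$. A $\zeta$-pyramid at claw $(v,e_1,e_2,e_3)$ (distinct edges at $v$) is a pyramid with apex $a$, base $b_1b_2b_3$, paths $P_i$ with $b_i\in\zeta(e_i,v)$ and a leaf $l_i$ in the component of $T-e_i$ not containing $v$ such that, for $\Lambda_i$ the $T$-path from $v$ to $l_i$, $P_i=\Gamma_i\cup\{a\}$, $\Gamma_i$ a path in $\bigcup_{e\in E(\Lambda_i)}\zeta(e)$, $\Gamma_i\cap\zeta(e_i)$ a long $\zeta(e_i)$-rung and $\Gamma_i\cap\zeta(e)$ a $\zeta(e)$-rung for other $e\in E(\Lambda_i)$. A vertex $p\in V(G)\setminus\zeta^+(T)$ is a jewel for $\zeta$ at seagull $(v,e_1,e_2)$ (distinct edges at $v$) if for some $e_3\notin\{e_1,e_2\}$ at $v$ there is a $\zeta$-pyramid at $(v,e_1,e_2,e_3)$ with $b_i\in\zeta(e_i,v)$ such that $p$ is a jewel for it at $b_3$. $\mathcal{J}_{\zeta,v}$ = set of jewels for $\zeta$ at seagulls at $v$. *)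

(* Defs.v *)
From mathcomp Require Import all_boot.
From mathcomp Require Import boolp.

Set Implicit Arguments.
Unset Strict Implicit.
Unset Printing Implicit Defensive.

(** * Finite simple graphs *)

Record sgraph := SGraph {
  svertex :> finType;
  sedge : rel svertex;
  sedge_sym : symmetric sedge;
  sedge_irr : irreflexive sedge }.

Notation "x -- y" := (sedge x y) (at level 30).

Section Graphs.
Variable G : sgraph.
Implicit Types (x y : G) (A B H K : {set G}) (p : seq G).

Definition clique K : Prop := {in K &, forall x y, x != y -> x -- y}.
Definition stable K : Prop := {in K &, forall x y, ~~ (x -- y)}.
Definition complete A B : Prop := {in A & B, forall x y, x -- y}.
Definition anticomplete A B : Prop := {in A & B, forall x y, ~~ (x -- y)}.

Definition degree_in H x : nat := #|[set y in H | x -- y]|.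
Definition degree x : nat := degree_in setT x.
Definition max_degree : nat := \max_(x : G) degree x.
Definition leaf x : bool := degree x == 1.

Definition dist_le (k : nat) x y : Prop :=
  exists p, [/\ path (@sedge G) x p, last x p = y & size p <= k].

Definition component H x : {set G} :=
  [set y | connect [rel u w | [&& u \in H, w \in H & u -- w]] x y].
Definition components H : {set {set G}} := [set component H x | x in H].

Definition is_edge (e : {set G}) : bool :=
  [exists x, exists y, (x -- y) && (e == [set x; y])].
Definition edge := {e : {set G} | is_edge e}.

Definition connected : Prop := forall x y, connect (@sedge G) x y.
Definition acyclic : Prop := forall c, 2 < size c -> ~~ ucycleb (@sedge G) c.
Definition tree : Prop := connected /\ acyclic.
Definition smooth : Prop :=
  3 <= #|G| /\ forall x, leaf x \/ 2 < degree x.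

(* All paths are induced; a path is given by the list of all its vertices, in
   order, so that a one-vertex path is a singleton list. *)
Definition is_path p : Prop :=
  [/\ p != [::], uniq p, sorted (@sedge G) p &
      {in p &, forall x y, x -- y ->
         index y p = (index x p).+1 \/ index x p = (index y p).+1}].

Definition path_between x y p : Prop :=
  [/\ is_path p, head x p = x & last x p = y].

Definition plength p : nat := (size p).-1.

Definition interior x y p : {set G} := [set z in p] :\: [set x; y].

Definition triangle (b : 'I_3 -> G) : Prop :=
  forall i j, i != j -> b i -- b j.

Definition is_theta (a b : G) (P : 'I_3 -> seq G) : Prop :=
  [/\ a != b, ~~ (a -- b),
      forall i, path_between a b (P i) /\ 2 <= plength (P i) &
      forall i j, i != j ->
        [disjoint interior a b (P i) & interior a b (P j)] /\
        anticomplete (interior a b (P i)) (interior a b (P j))].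

Definition is_prism (a b : 'I_3 -> G) (P : 'I_3 -> seq G) : Prop :=
  [/\ triangle a /\ triangle b,
      forall i j, a i != b j,
      forall i, path_between (a i) (b i) (P i),
      forall i j, i != j -> [disjoint P i & P j] &
      forall i j x y, i != j -> x \in P i -> y \in P j -> x -- y ->
        (x = a i /\ y = a j) \/ (x = b i /\ y = b j)].

Definition theta_free : Prop := ~ exists a b P, is_theta a b P.
Definition prism_free : Prop := ~ exists a b P, is_prism a b P.

Definition is_pyramid (a : G) (b : 'I_3 -> G) (P : 'I_3 -> seq G) : Prop :=
  [/\ triangle b,
      forall i, path_between a (b i) (P i) /\ 1 <= plength (P i),
      forall i j x, i != j -> x \in P i -> x \in P j -> x = a,
      forall i j x y, i != j -> x \in [set z in P i] :\ a ->
        y \in [set z in P j] :\ a -> x -- y -> x = b i /\ y = b j &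
      forall i j, plength (P i) = 1 -> plength (P j) = 1 -> i = j].

Definition jewel_for_pyramid (b : 'I_3 -> G) (P : 'I_3 -> seq G)
    (i : 'I_3) (x : G) : Prop :=
  [/\ forall j, x \notin P j,
      anticomplete [set x] [set z in P i] &
      forall j, j != i ->
        [set z in P j | x -- z] = [set z in P j | (z == b j) || (b j -- z)]].

Definition trapped (a : G) H : Prop :=
  (forall x, dist_le 2 a x -> x \in H) /\
  (forall x, a -- x -> degree_in H x = 2).

End Graphs.

Definition ramsey_property (p q n : nat) : Prop :=
  forall G : sgraph, n <= #|G| ->
    (exists K : {set G}, #|K| = p /\ clique K) \/
    (exists K : {set G}, #|K| = q /\ stable K).

Definition is_ramsey_number (p q r : nat) : Prop :=
  ramsey_property p q r /\ forall n, ramsey_property p q n -> r <= n.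

(** * Strip structures *)

(* The three components are the restrictions of zeta to V(T), E(T) and
   E(T) x V(T). *)
Record strip (T G : sgraph) := Strip {
  sv : T -> {set G};
  se : edge T -> {set G};
  sev : edge T -> T -> {set G} }.

Section Strips.
Variables (T G : sgraph) (z : strip T G) (a : G).
Implicit Types (u v l : T) (e f : edge T) (S : {set T}).

Definition zeta_set S : {set G} :=
  (\bigcup_(v in S) sv z v) :|: (\bigcup_(e : edge T | val e \subset S) se z e).
Definition zeta_all : {set G} := zeta_set setT.
Definition zeta_plus : {set G} := a |: zeta_all.

Definition zeta_B v : {set G} := \bigcup_(e : edge T | v \in val e) sev z e v.
Definition zeta_int e : {set G} := se z e :\: \bigcup_(v in val e) sev z e v.

Record strip_structure : Prop := StripStructure {
  strip_avoids_v : forall v, a \notin sv z v;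
  strip_avoids_e : forall e, a \notin se z e;
  strip_avoids_ev : forall e v, a \notin sev z e v;
  S1_vv : forall u v, u != v -> [disjoint sv z u & sv z v];
  S1_ee : forall e f, e != f -> [disjoint se z e & se z f];
  S1_ve : forall v e, [disjoint sv z v & se z e];
  S2 : forall l, leaf l -> sv z l = set0;
  S3_sub : forall e v, sev z e v \subset se z e;
  S3_inc : forall e v, sev z e v != set0 <-> v \in val e;
  S4_complete : forall e f v, e != f -> complete (sev z e v) (sev z f v);
  S4_only : forall e f x y, e != f -> x \in se z e -> y \in se z f ->
    x -- y -> exists v, x \in sev z e v /\ y \in sev z f v;
  S5 : forall e v x, v \in val e -> x \in se z e ->
    exists y p, [/\ y \in sev z e v, path_between x y p,
      {subset p <= se z e} & interior x y p \subset zeta_int e];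
  S6 : forall v e, anticomplete (sv z v) (se z e :\: sev z e v);
  S7 : forall v C, C \in components (sv z v) ->
    exists x y, [/\ x \in C, y \in zeta_B v & x -- y];
  S8_complete : forall l e, leaf l -> l \in val e ->
    complete [set a] (sev z e l);
  S8_only : forall x, x \in zeta_all -> a -- x ->
    exists l e, [/\ leaf l, l \in val e & x \in sev z e l] }.

Definition rich : Prop :=
  trapped a zeta_plus /\
  forall l e, leaf l -> l \in val e -> #|sev z e l| = 1.

(* Rungs are taken as vertex sets, since they arise as intersections of a path
   with some zeta(e). *)
Definition rung e (R : {set G}) : Prop :=
  exists u v, val e = [set u; v] /\
    ((#|R| = 1 /\ R \subset sev z e u :&: sev z e v) \/
     exists x y p, [/\ R = [set w in p] /\ R \subset se z e,
       path_between x y p,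
       x \in sev z e u :\: sev z e v,
       y \in sev z e v :\: sev z e u &
       interior x y p \subset zeta_int e]).

Definition long_rung e (R : {set G}) : Prop := rung e R /\ 2 <= #|R|.

Definition del_edge e : rel T := [rel x y | (x -- y) && ([set x; y] != val e)].

(* The pyramid has paths P_i = a :: Gam i, listed from a to b i.  As Lam is an
   induced path, its edges are the edges of T with both ends on Lam. *)
Definition zeta_pyramid v (e : 'I_3 -> edge T) (b : 'I_3 -> G)
    (Gam : 'I_3 -> seq G) : Prop :=
  [/\ injective e /\ forall i, v \in val (e i),
      is_pyramid a b (fun i => a :: Gam i),
      forall i, b i \in sev z (e i) v &
      forall i, exists l Lam,
        [/\ leaf l /\ ~~ connect (del_edge (e i)) v l,
            path_between v l Lam,
            is_path (Gam i) /\ [set x in Gam i] \subset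
              \bigcup_(f : edge T | val f \subset [set u in Lam]) se z f,
            long_rung (e i) ([set x in Gam i] :&: se z (e i)) &
            forall f, val f \subset [set u in Lam] -> f != e i ->
              rung f ([set x in Gam i] :&: se z f)]].

(* The base vertex b_3 has index ord_max : 'I_3. *)
Definition jewel_at_seagull v (e1 e2 : edge T) (x : G) : Prop :=
  [/\ e1 != e2, v \in val e1, v \in val e2, x \notin zeta_plus &
      exists e3 : edge T, [/\ e3 != e1, e3 != e2, v \in val e3 &
        exists b Gam, zeta_pyramid v (tnth [tuple e1; e2; e3]) b Gam /\
          jewel_for_pyramid b (fun i => a :: Gam i) ord_max x]].

Definition jewels v : {set G} :=
  [set x | `[< exists e1 e2, jewel_at_seagull v e1 e2 x >]].

End Strips.

Definition jewel_bound (t delta j : nat) : Prop :=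
  forall (G : sgraph) (a : G) (T : sgraph) (z : strip T G) (v : T),
    theta_free G -> prism_free G ->
    (forall K : {set G}, clique K -> #|K| <> t) ->
    tree T -> smooth T -> max_degree T = delta ->
    strip_structure z a -> rich z a ->
    #|jewels z a v| < j.

(* Main.v *)
Require Import Defs.
From mathcomp Require Import all_boot.
From mathcomp Require Import boolp.

(* Two non-adjacent jewels x, y at the same seagull (v, e1, e2) yield a theta or
   a prism, so the jewels at a seagull form a clique, of size less than
   t <= R(t, 3), and there are at most 'C(delta, 2) seagulls at v.

   Call "arm" of e a path from zeta(e, v) to the apex a that leaves v through e.
   Jewels have no neighbour in common with a, as a is trapped.  Exchanging one
   path of a pyramid for another arm of the same edge, theta- and
   prism-freeness show that a jewel x at (v, e1, e2) either misses an arm of e1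
   or is adjacent precisely to its first two vertices, likewise for e2, and that
   it misses the arms of all other edges.  If x and y attach to a common arm of
   e1 and to a common arm of e2, there is a theta whose ends are the second
   vertices of these arms, with x and y as interiors of two of its paths.
   Otherwise, up to symmetry, x attaches to an arm b1 b1' ... of e1 that y
   misses and y to an arm c1 c1' ... of e1 that x misses, and then x b1 b1' and
   y c1 c1' are the triangles of a prism: b1 and c1 are joined directly or
   through the third base vertex, the other two paths run through the arms of
   e1 and of e2.  They avoid a because two arms of one edge always meet or touch
   before reaching a. *)

Set Implicit Arguments.
Unset Strict Implicit.
Unset Printing Implicit Defensive.

(** * Induced paths *)

Section InducedPaths.
Variable G : sgraph.
Implicit Types (x y u w : G) (s t p q H : seq G).

Definition within H : rel G := [rel u w | [&& u \in H, w \in H & u -- w]].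

Lemma within_sym H : connect_sym (within H).
Proof.
apply: sym_connect_sym => u w; rewrite /within /= sedge_sym.
by case: (_ \in _); case: (_ \in _).
Qed.

Lemma within_edge H x y : x \in H -> y \in H -> x -- y -> connect (within H) x y.
Proof. by move=> xH yH xy; apply: connect1; rewrite /within /= xH yH. Qed.

Lemma within_sorted H s x y : sorted (@sedge G) s -> {subset s <= H} ->
  x \in s -> y \in s -> connect (within H) x y.
Proof.
case: s => // h s /= hs sH.
suff Hh z : z \in h :: s -> connect (within H) h z.
  by move=> /Hh hx /Hh; apply: connect_trans; rewrite within_sym.
elim: s h hs sH => [|k s IHs] h /=; first by move=> _ _; rewrite inE => /eqP->.
case/andP=> hk ks sH; rewrite inE => /predU1P[-> //|zs].
apply: connect_trans (IHs k ks _ zs).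
  by apply: within_edge => //; apply: sH; rewrite !inE eqxx ?orbT.
by move=> u us; apply: sH; rewrite inE us orbT.
Qed.

(** Recursive form of inducedness for [x :: p]: each vertex sees the next one and nothing later. It
    lets induced paths grow at their head. *)
Fixpoint ipath x p : bool :=
  if p is y :: p' then
    [&& x -- y, x \notin p, all (fun w => ~~ (x -- w)) p' & ipath y p']
  else true.

Lemma ipath_is_path x p : ipath x p -> is_path (x :: p).
Proof.
move=> ip; split=> //.
- elim: p x ip => //= y p IHp x /and4P[_ xp _ /IHp].
  by rewrite xp.
- by elim: p x ip => //= y p IHp x /and4P[-> _ _ /IHp].
- elim: p x ip => [|y p IHp] x.
    by move=> _ u w; rewrite !inE => /eqP-> /eqP->; rewrite sedge_irr.
  case/and4P=> xy xp xfar /IHp{}IHp.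
  have shift u : u \in y :: p ->
      index u (x :: y :: p) = (index u (y :: p)).+1.
    by move=> up; rewrite /=; case: eqP => // xu; rewrite xu up in xp.
  have head w : w \in y :: p -> x -- w ->
      index w (x :: y :: p) = (index x (x :: y :: p)).+1.
    move=> wp xw; rewrite shift // /= !eqxx.
    move: wp; rewrite inE => /predU1P[-> | wp]; first by rewrite eqxx.
    by have := allP xfar w wp; rewrite xw.
  move=> u w; rewrite (in_cons x (y :: p)) => /predU1P[-> | up];
    rewrite (in_cons x (y :: p)) => /predU1P[-> | wp].
  + by rewrite sedge_irr.
  + by left; apply: head.
  + by rewrite sedge_sym; right; apply: head.
  + move=> uw; rewrite !shift //.
    by case: (IHp u w up wp uw) => ->; [left | right].
Qed.

Lemma ipath_suffix x p y : ipath x p -> y \in x :: p ->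
  exists q, [/\ ipath y q, last y q = last x p & {subset y :: q <= x :: p}].
Proof.
elim: p x => [|k p IHp] x ip.
  by rewrite mem_seq1 => /eqP->; exists [::]; split.
rewrite in_cons => /predU1P[-> | yp]; first by exists (k :: p); split.
case/and4P: ip => _ _ _ ip; have [q [iq lq sq]] := IHp k ip yp.
by exists q; split=> // u /sq up; rewrite inE up orbT.
Qed.

(** The head is dropped as long as a later neighbour of [x] exists, so [x] ends up in front of its
    last neighbour on the path. *)
Lemma ipath_extend x y p : ipath y p -> x \notin y :: p ->
    has (sedge x) (y :: p) ->
  exists q, [/\ ipath x q, last x q = last y p & {subset q <= y :: p}].
Proof.
elim: p y => [|k p IHp] y ip xp hx.
  exists [:: y]; split=> //=.
  by move: hx xp; rewrite /= orbF => -> ->.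
have [hx' | nx] := boolP (has (sedge x) (k :: p)).
  have [|||q [iq lq sq]] := IHp k; rewrite ?hx' //.
  - by case/and4P: ip.
  - by move: xp; rewrite inE negb_or => /andP[].
  by exists q; split=> // u /sq up; rewrite inE up orbT.
exists (y :: k :: p); split=> //; apply/and4P; split=> //.
- by case/orP: hx => // /(negP nx).
- by rewrite -all_predC in nx.
Qed.

(* A shortest path is built from its far end: a vertex is joined to its last
   neighbour on the induced path found so far. *)
Lemma within_path H x y : x \in H -> connect (within H) x y ->
  exists p, path_between x y p /\ {subset p <= H}.
Proof.
move=> xH /connectP[p hp ->].
suff [q [iq lq sq]] : exists q,
    [/\ ipath x q, last x q = last x p & {subset x :: q <= H}].
  by exists (x :: q); split=> //; split=> //; apply: ipath_is_path.
elim: p x xH hp => [|k p IHp] x xH.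
  by exists [::]; split=> // u; rewrite mem_seq1 => /eqP->.
case/andP=> /and3P[_ kH xk] hp; have [q [iq lq sq]] := IHp k kH hp.
have [xq | xq] := boolP (x \in k :: q).
  have [r [ir lr sr]] := ipath_suffix iq xq.
  by exists r; split; rewrite ?lr // => u /sr /sq.
have [|r [ir lr sr]] := ipath_extend iq xq; first by rewrite /= xk.
exists r; split; rewrite ?lr // => u; rewrite in_cons => /predU1P[-> //|].
by move/sr/sq.
Qed.

(** An edge would force consecutive positions, while [x] sits strictly between [u] and [w]. *)
Lemma is_path_gap s x t u w : is_path (s ++ x :: t) -> u \in s -> w \in t ->
  (u != w) && ~~ (u -- w).
Proof.
case=> _ uq _ ind us wt.
move: (uq); rewrite cat_uniq => /and3P[_ /hasPn/(_ w) ws /= /andP[xt _]].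
have {}ws : w \notin s by apply: ws; rewrite in_cons wt orbT.
have uw : u != w by apply: contraNneq ws => <-.
rewrite uw; apply/negP => e.
have := ind u w; rewrite !mem_cat us !in_cons wt !orbT => /(_ isT isT e).
rewrite !index_cat us (negPf ws) /=.
have -> : x == w = false by apply: contraNF xt => /eqP->.
have lt : index u s < size s by rewrite index_mem.
case=> eq; move: lt.
  by move: eq; rewrite addnS => -[<-]; rewrite ltnNge leq_addr.
by rewrite eq ltnNge ltnW // ltnS leq_addr.
Qed.

(** * Thetas and prisms from connected sets *)

Definition far u w := (u != w) && ~~ (u -- w).

Lemma far_sym u w : far u w = far w u.
Proof. by rewrite /far eq_sym sedge_sym. Qed.

Definition apart s t : Prop := {in s & t, forall u w, far u w}.

Lemma apart_sym s t : apart s t -> apart t s.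
Proof. by move=> st u w us wt; rewrite far_sym st. Qed.

Lemma ord3P (i : 'I_3) : [\/ i = 0 :> nat, i = 1 :> nat | i = 2 :> nat].
Proof. by case: i => -[|[|[|]]] //= _; [constructor 1 | constructor 2 | constructor 3]. Qed.

(** No paths need to be exhibited: an induced path chosen inside each connected set has its interior
    in the corresponding [s], and the interiors inherit separation. Non-adjacency of the ends gives
    length at least two. *)
Lemma no_theta a b s1 s2 s3 : theta_free G -> a != b -> ~~ (a -- b) ->
  connect (within [:: a, b & s1]) a b ->
  connect (within [:: a, b & s2]) a b ->
  connect (within [:: a, b & s3]) a b ->
  apart s1 s2 -> apart s1 s3 -> apart s2 s3 -> False.
Proof.
move=> free ab nab c1 c2 c3 s12 s13 s23; apply: free.
pose S i := nth [::] [:: s1; s2; s3] i.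
have /choice[P HP] (i : 'I_3) :
    exists p, path_between a b p /\ {subset p <= [:: a, b & S i]}.
  apply: within_path; first by rewrite mem_head.
  by rewrite /S; case: (ord3P i) => ->.
have inS i u : u \in interior a b (P i) -> u \in S i.
  rewrite !inE negb_or => /andP[/andP[ua ub] /(HP i).2].
  by rewrite !inE (negPf ua) (negPf ub).
have sep (i j : 'I_3) : i != j -> apart (S i) (S j).
  rewrite -val_eqE /= /S.
  by case: (ord3P i) => ->; case: (ord3P j) => -> //= _; apply: apart_sym.
exists a, b, P; split=> // [i | i j ij].
  split; first by case: (HP i).
  case: (HP i) => -[[ne _ so _] hd la] _.
  case: (P i) ne so hd la => [|u [|w [|? ?]]] //= _.
    by move=> _ -> eab; rewrite eab eqxx in ab.
  by rewrite andbT => e ea eb; move: nab; rewrite -ea -eb e.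
split.
  rewrite disjoint_subset; apply/subsetP => u /inS ui; rewrite inE.
  apply/negP => /inS uj; have := sep _ _ ij _ _ ui uj.
  by rewrite /far eqxx.
by move=> u w /inS ui /inS wj; have /andP[] := sep _ _ ij _ _ ui wj.
Qed.

(** Again induced paths are chosen inside connected sets. The sets are disjoint automatically, since
    the only pairs not far apart are edges of the two triangles. *)
Lemma no_prism a1 a2 a3 b1 b2 b3 s1 s2 s3 : prism_free G ->
  [/\ a1 -- a2, a1 -- a3 & a2 -- a3] -> [/\ b1 -- b2, b1 -- b3 & b2 -- b3] ->
  [/\ a1 != b1, a2 != b2 & a3 != b3] ->
  [/\ a1 \in s1, a2 \in s2 & a3 \in s3] ->
  [/\ b1 \in s1, b2 \in s2 & b3 \in s3] ->
  [/\ connect (within s1) a1 b1, connect (within s2) a2 b2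
    & connect (within s3) a3 b3] ->
  {in s1 & s2, forall u w, [\/ far u w, u = a1 /\ w = a2 | u = b1 /\ w = b2]} ->
  {in s1 & s3, forall u w, [\/ far u w, u = a1 /\ w = a3 | u = b1 /\ w = b3]} ->
  {in s2 & s3, forall u w, [\/ far u w, u = a2 /\ w = a3 | u = b2 /\ w = b3]} ->
  False.
Proof.
move=> free [a12 a13 a23] [b12 b13 b23] [n1 n2 n3] [m1 m2 m3] [k1 k2 k3].
move=> [c1 c2 c3] s12 s13 s23; apply: free.
pose S i := nth [::] [:: s1; s2; s3] i.
pose a i := nth a1 [:: a1; a2; a3] i.
pose b i := nth b1 [:: b1; b2; b3] i.
have aS i : i < 3 -> a i \in S i by case: i => [|[|[|]]].
have bS i : i < 3 -> b i \in S i by case: i => [|[|[|]]].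
have /choice[P HP] (i : 'I_3) :
    exists p, path_between (a i) (b i) p /\ {subset p <= S i}.
  apply: within_path; first exact: aS.
  by rewrite /S /a /b; case: (ord3P i) => ->.
have ta (i j : 'I_3) : i != j -> a i -- a j.
  rewrite -val_eqE /= /a.
  by case: (ord3P i) => ->; case: (ord3P j) => -> //= _; rewrite sedge_sym.
have tb (i j : 'I_3) : i != j -> b i -- b j.
  rewrite -val_eqE /= /b.
  by case: (ord3P i) => ->; case: (ord3P j) => -> //= _; rewrite sedge_sym.
have sep (i j : 'I_3) : i != j -> {in S i & S j, forall u w,
    [\/ far u w, u = a i /\ w = a j | u = b i /\ w = b j]}.
  rewrite -val_eqE /= /a /b /S.
  have flip s t x x' y y' :
      {in s & t, forall u w, [\/ far u w, u = x /\ w = x' | u = y /\ w = y']} ->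
      {in t & s, forall u w, [\/ far u w, u = x' /\ w = x | u = y' /\ w = y]}.
    move=> st u w ut ws; rewrite far_sym; case: (st w u ws ut) => [?|[? ?]|[? ?]].
    - by constructor 1.
    - by constructor 2.
    - by constructor 3.
  by case: (ord3P i) => ->; case: (ord3P j) => -> //= _; apply: flip.
have sepn (i j : 'I_3) u w : i != j -> u \in S i -> w \in S j -> u != w.
  move=> ij ui wj; case: (sep _ _ ij _ _ ui wj) => [/andP[//]|[-> ->]|[-> ->]].
    by apply: contraTneq (ta _ _ ij) => ->; rewrite sedge_irr.
  by apply: contraTneq (tb _ _ ij) => ->; rewrite sedge_irr.
exists (fun i : 'I_3 => a i), (fun i : 'I_3 => b i), P; split=> //.
- move=> i j; have [<- | ij] := eqVneq i j.
    by rewrite /a /b; case: (ord3P i) => ->.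
  exact: sepn ij (aS _ (ltn_ord i)) (bS _ (ltn_ord j)).
- by move=> i; case: (HP i).
- move=> i j ij; rewrite disjoint_subset; apply/subsetP => u ui.
  rewrite inE; apply/negP => uj.
  by have := sepn _ _ _ _ ij ((HP i).2 _ ui) ((HP j).2 _ uj); rewrite eqxx.
- move=> i j u w ij ui wj e.
  case: (sep _ _ ij _ _ ((HP i).2 _ ui) ((HP j).2 _ wj)); first 1 last.
  + by left.
  + by right.
  + by rewrite /far e andbF.
Qed.
End InducedPaths.

(** * Jewels on abstract arms *)

(** Membership goals become boolean tautologies in their atoms, which are settled by cases. *)
Ltac mem_tac :=
  by rewrite ?(inE, mem_cat, mem_rcons);
     do ?[case: (_ == _) | case: (_ \in _)].
Ltac sub_tac := by move=> ?; mem_tac.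

Section Arms.
(** Abstract setting: indices stand for edges of the tree at [v], [Z i] for the strips behind such
    an edge, and [W i] for the part of its strip at [v]. *)
Variables (G : sgraph) (a : G) (I : eqType) (Z W : I -> {set G}).
Hypotheses (thetaG : theta_free G) (prismG : prism_free G).
Hypothesis Z_a : forall i, a \notin Z i.
Hypothesis W_sub : forall i, W i \subset Z i.
Hypothesis Z_sep : forall i j u w, i != j -> u \in Z i -> w \in Z j ->
  far u w \/ (u \in W i /\ w \in W j).
Hypothesis W_complete : forall i j, i != j -> complete (W i) (W j).
Implicit Types (i j k : I) (x y u w b c d e : G) (p q r s t H A B : seq G).

(** Lists run from the apex to the root [b], so the first two vertices seen from [v] come last.
    Keeping [s] off [W i] makes [s] far from every other zone; only roots of different arms are
    adjacent. *)
Record arm i s b : Prop := Arm {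
  arm_path : is_path (a :: rcons s b);
  arm_sub : {subset s <= Z i};
  arm_root : b \in W i;
  arm_off : forall u, u \in s -> u \notin W i }.

(** By the last clause a neighbour of [x] is non-adjacent to [a], so that it can form the ends of a
    theta together with [a]. *)
Definition outside x : Prop :=
  [/\ forall i, x \notin Z i, x != a, ~~ (a -- x) &
      forall u, x -- u -> ~~ (a -- u)].

Definition misses x s : Prop := {in s, forall u, ~~ (x -- u)}.

Definition attaches x s b : Prop :=
  exists s' b', [/\ s = rcons s' b', x -- b, x -- b' & misses x s'].

Lemma arm_in i s b u : arm i s b -> u \in rcons s b -> u \in Z i.
Proof.
move=> h; rewrite mem_rcons in_cons => /predU1P[-> | /(arm_sub h)//].
by rewrite (subsetP (W_sub i)) ?(arm_root h).
Qed.

Lemma arm_sorted i s b : arm i s b -> sorted (@sedge G) (a :: rcons s b).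
Proof. by case/arm_path. Qed.

Lemma arm_sortedW i s b : arm i s b -> sorted (@sedge G) (a :: s).
Proof. by move/arm_sorted; rewrite /= rcons_path => /andP[]. Qed.

Lemma arm_far i j s b u w : i != j -> arm i s b -> u \in s -> w \in Z j -> far u w.
Proof.
move=> ij h us wj; case: (Z_sep ij (arm_sub h us) wj) => // -[ui _].
by have := arm_off h us; rewrite ui.
Qed.

Lemma far_out i x w : outside x -> w \in Z i -> ~~ (x -- w) -> far x w.
Proof.
case=> xZ _ _ _ wZ nxw; rewrite /far nxw andbT.
by apply: contraNneq (xZ i) => ->.
Qed.

Lemma connect_via H x u y : x \in H -> u \in H -> x -- u ->
  connect (within H) u y -> connect (within H) x y.
Proof. by move=> xH uH xu; apply: connect_trans; apply: within_edge. Qed.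

Lemma connect_out x u s : sorted (@sedge G) (a :: s) -> u \in s -> x -- u ->
  connect (within [:: x, a & s]) x a.
Proof.
move=> so us xu; apply: (connect_via (u := u)) => //.
- by rewrite mem_head.
- by rewrite !inE us !orbT.
- by apply: (within_sorted so); rewrite ?inE ?us ?eqxx ?orbT //; sub_tac.
Qed.

Lemma arm_rcons i s v b : arm i (rcons s v) b ->
  b -- v /\ {in s, forall u, far b u}.
Proof.
move=> h; have := arm_path h; have := arm_sorted h.
rewrite -!cats1 -catA -cat_cons => /= so pr; split.
  by rewrite sedge_sym; move: so; rewrite cat_path /= => /and4P[].
move=> u us; rewrite far_sym.
by apply: (is_path_gap (s := a :: s) pr);
  rewrite ?mem_seq1 ?eqxx ?in_cons ?us ?orbT.
Qed.

(** Otherwise [x] and [a] are the ends of a theta along the three arms. Only the third path may use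
    a root, so no two roots spoil the separation. *)
Lemma miss_third i j k p b q c r d x : i != j -> i != k -> j != k ->
    arm i p b -> arm j q c -> arm k r d -> outside x ->
    has (sedge x) p -> has (sedge x) q ->
  misses x (rcons r d).
Proof.
move=> ij ik jk hp hq hr xo /hasP[b' b'p xb'] /hasP[c' c'q xc'] u ur.
apply/negP => xu; have [_ xa nxa _] := xo.
apply: (@no_theta _ x a p q (rcons r d)) => //.
- by rewrite sedge_sym.
- exact: connect_out (arm_sortedW hp) b'p xb'.
- exact: connect_out (arm_sortedW hq) c'q xc'.
- exact: connect_out (arm_sorted hr) ur xu.
- by move=> v w vp wq; apply: arm_far ij hp vp (arm_sub hq wq).
- by move=> v w vp wr; apply: arm_far ik hp vp (arm_in hr wr).
- by move=> v w vq wr; apply: arm_far jk hq vq (arm_in hr wr).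
Qed.

Lemma first_neighbor x s : has (sedge x) s ->
  exists A v B, [/\ s = A ++ v :: B, x -- v & misses x A].
Proof.
case/split_find=> v A B xv; rewrite -all_predC => /allP xA.
by exists A, v, B; rewrite cat_rcons.
Qed.

(* Let v be the neighbour of x on the arm nearest to [a].  If x has no further
   neighbour, v and [a] are the ends of a theta; if it has one not following v,
   x and [a] are; if it is adjacent to v and the next vertex v' <> d only, x v' v
   and c d e are the triangles of a prism. *)
Lemma attach_or_miss i j k r d q c s e x : i != j -> i != k -> j != k ->
    arm i r d -> arm j q c -> arm k s e -> outside x ->
    x -- c -> has (sedge x) q -> misses x (rcons s e) ->
  misses x (rcons r d) \/ attaches x r d.
Proof.
move=> ij ik jk hr hq hs xo xc /hasP[c' c'q xc'] xs.
have [xZ xa nax xtrap] := xo.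
have [hx | nx] := boolP (has (sedge x) (rcons r d)); last first.
  by left=> u ur; apply: (hasPn nx).
right; have [A [v [B [eq xv xA]]]] := first_neighbor hx.
have pr := arm_path hr; rewrite eq -cat_cons in pr.
have gapAB := is_path_gap pr.
have so : sorted (@sedge G) ((a :: A) ++ v :: B) by case: pr.
have soA : sorted (@sedge G) (a :: rcons A v).
  by move: so; rewrite -cat_rcons /= cat_path => /andP[].
have soB : sorted (@sedge G) (v :: B) by move: so; rewrite /= cat_path => /= /and3P[].
have uq : uniq ((a :: A) ++ v :: B) by case: pr.
have vB : v \notin B.
  by move: uq; rewrite cat_uniq => /and3P[_ _ /= /andP[]].
have AvB u : u \in A ++ v :: B -> u \in Z i by rewrite -eq; apply: arm_in hr.
have BZ u : u \in B -> u \in Z i.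
  by move=> uB; apply: AvB; rewrite mem_cat in_cons uB !orbT.
have vZ : v \in Z i by apply: AvB; rewrite mem_cat mem_head orbT.
have dvB : d \in v :: B.
  have : last d (rcons r d) = d by rewrite last_rcons.
  by rewrite eq last_cat /= => {1}<-; apply: mem_last.
(* The root [d] lies in [v :: B], so [A] stays off the roots and is far from the other zones. *)
have Ar : {subset A <= r}.
  case/lastP: B eq {gapAB pr so soB uq vB AvB BZ dvB} => [eq | B ? eq] u.
    by move: eq; rewrite cats1 => /rcons_inj[->].
  move: eq; rewrite -rcons_cons -rcons_cat => /rcons_inj[-> _].
  by rewrite mem_cat => ->.
have AZ u : u \in A -> u \in Z i by move/Ar/(arm_sub hr).
have eW := arm_root hs; have dW := arm_root hr; have cW := arm_root hq.
have de : d -- e by apply: (W_complete ik).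
have nva : ~~ (v -- a) by rewrite sedge_sym; apply: xtrap.
have va : v != a by apply: contraNneq (Z_a i) => <-.
have conn_s H : e \in H -> {subset a :: rcons s e <= H} ->
    connect (within H) e a.
  by move=> eH sH; apply: (within_sorted (arm_sorted hs)) => //;
     rewrite !inE ?mem_rcons ?mem_head ?eqxx ?orbT.
have far_xs u : u \in rcons s e -> far x u.
  by move=> us; apply: far_out xo (arm_in hs us) (xs _ us).
have far_xA u : u \in A -> far x u.
  by move=> uA; apply: far_out xo (AZ _ uA) (xA _ uA).
have [hB | nB] := boolP (has (sedge x) B); last first.
  have far_xB u : u \in B -> far x u.
    by move=> uB; apply: far_out xo (BZ _ uB) (hasPn nB _ uB).
  (* The three paths from [v] to [a] run along [A], through [x] and [q], and up to [d], over to [e]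
     and down the third arm. *)
  exfalso; apply: (@no_theta _ v a A (x :: q) (B ++ rcons s e)) => //.
  - by apply: (within_sorted soA); rewrite ?inE ?mem_rcons ?mem_head ?eqxx ?orbT //; sub_tac.
  - apply: (connect_via (u := x)); rewrite ?inE ?eqxx ?orbT // 1?sedge_sym //.
    apply: (connect_via (u := c')); rewrite ?inE ?eqxx ?c'q ?orbT //.
    by apply: (within_sorted (arm_sortedW hq)); rewrite ?inE ?c'q ?eqxx ?orbT //; sub_tac.
  - apply: (@connect_trans _ _ d).
      by apply: (within_sorted soB); rewrite ?mem_head //; sub_tac.
    apply: (connect_via (u := e)) => //.
    + by move: dvB; mem_tac.
    + by rewrite !inE mem_cat mem_rcons mem_head !orbT.
    + by apply: conn_s; [rewrite !inE mem_cat mem_rcons mem_head !orbT | sub_tac].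
  - move=> u w uA; rewrite in_cons => /predU1P[-> | wq].
      by rewrite far_sym far_xA.
    exact: arm_far ij hr (Ar _ uA) (arm_sub hq wq).
  - move=> u w uA; rewrite mem_cat => /orP[wB | ws].
      by apply: gapAB; rewrite // in_cons uA orbT.
    exact: arm_far ik hr (Ar _ uA) (arm_in hs ws).
  - move=> u w; rewrite in_cons mem_cat => /predU1P[-> | uq'] /orP[wB | ws].
    + exact: far_xB.
    + exact: far_xs.
    + by apply: arm_far hq uq' (BZ _ wB); rewrite eq_sym.
    + exact: arm_far jk hq uq' (arm_in hs ws).
case: B hB eq pr gapAB so soB uq vB AvB BZ dvB => // v' B.
move=> hB eq pr gapAB so soB uq vB AvB BZ dvB.
have vd : v != d.
  apply: contraNneq vB => vd; rewrite vd.
  have : last d (rcons r d) = d by rewrite last_rcons.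
  by rewrite eq last_cat /= => {1}<-; apply: mem_last.
have {}dvB : d \in v' :: B by move: dvB; rewrite in_cons eq_sym (negPf vd).
have vr : v \in r.
  have : v \in rcons r d by rewrite eq mem_cat mem_head orbT.
  by rewrite mem_rcons in_cons (negPf vd).
(* If [v'] ends the arm, it is [d], and [x] attaches. Otherwise [D] collects the vertices after
   [v']. *)
case: B => [|v'' B] in hB eq pr gapAB so soB uq vB AvB BZ dvB *.
  move: eq; rewrite -[[:: v; v']]/(rcons [:: v] v') -rcons_cat => /rcons_inj[-> dv'].
  move: hB; rewrite /= orbF => xv'.
  by exists A, v; split; rewrite ?cats1 ?dv' // => u /xA.
have v'D : v' \notin v'' :: B.
  by move: uq; rewrite cat_uniq => /and3P[_ _ /and3P[]].
have v'd : v' != d.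
  apply: contraNneq v'D => v'd; rewrite v'd.
  have : last d (rcons r d) = d by rewrite last_rcons.
  by rewrite eq last_cat /= => {1}<-; apply: mem_last.
have {}dvB : d \in v'' :: B by move: dvB; rewrite in_cons eq_sym (negPf v'd).
set D := v'' :: B in hB eq pr gapAB so soB uq vB AvB BZ dvB v'D.
have soD : sorted (@sedge G) D by move: soB => /= /and3P[].
have pr' : is_path ((a :: rcons A v) ++ v' :: D) by rewrite /= cat_rcons.
have gapAD := is_path_gap pr'.
have Avr : {subset rcons A v <= r}.
  by move=> u; rewrite mem_rcons in_cons => /predU1P[-> // | /Ar].
have far_qs u w : u \in q -> w \in rcons s e -> far u w.
  by move=> uq' ws; apply: arm_far jk hq uq' (arm_in hs ws).
have far_qB u w : u \in q -> w \in v' :: D -> far u w.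
  by move=> uq' wB; apply: arm_far hq uq' (BZ _ wB); rewrite eq_sym.
have far_rs u w : u \in r -> w \in rcons s e -> far u w.
  by move=> ur ws; apply: arm_far ik hr ur (arm_in hs ws).
have [/hasP[u uD xu] | nD] := boolP (has (sedge x) D).
  (* A neighbour in [D] leads from [x] to [a] via [d] and [e], while [v] followed by [A] and the arm
     [q] give the other two paths. *)
  exfalso; apply: (@no_theta _ x a (rcons A v) q (D ++ rcons s e)) => //.
  - by rewrite sedge_sym.
  - by apply: connect_out soA _ xv; rewrite mem_rcons mem_head.
  - exact: connect_out (arm_sortedW hq) c'q xc'.
  - apply: (connect_via (u := u)) => //; rewrite ?mem_head //.
      by move: uD; mem_tac.
    apply: (@connect_trans _ _ d).
      by apply: (within_sorted soD) => //; sub_tac.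
    apply: (connect_via (u := e)) => //.
    + by move: dvB; mem_tac.
    + by rewrite !inE mem_cat mem_rcons mem_head !orbT.
    + by apply: conn_s; [rewrite !inE mem_cat mem_rcons mem_head !orbT | sub_tac].
  - by move=> y w /Avr yr wq; apply: arm_far ij hr yr (arm_sub hq wq).
  - move=> y w yA; rewrite mem_cat => /orP[wD | ws].
      by apply: gapAD; rewrite // in_cons yA orbT.
    exact: far_rs (Avr _ yA) ws.
  - move=> y w yq; rewrite mem_cat => /orP[wD | ws].
      by apply: far_qB; rewrite // in_cons wD orbT.
    exact: far_qs.
have xv' : x -- v' by case/orP: hB => // /(negP nD).
have far_xD u : u \in D -> far x u.
  move=> uD; apply: far_out xo _ (hasPn nD _ uD).
  by apply: BZ; rewrite in_cons uD orbT.
have vv' : v -- v' by case/andP: soB.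
have cd : c -- d by apply: (W_complete _ cW dW); rewrite eq_sym.
have ce : c -- e by apply: (W_complete jk).
have cZ := subsetP (W_sub j) _ cW.
have far_cr u : u \in r -> far c u.
  by move=> ur; rewrite far_sym; apply: arm_far ij hr ur cZ.
have far_cs u : u \in s -> far c u.
  by move=> us; rewrite far_sym; apply: arm_far hs us cZ; rewrite eq_sym.
have far_ds u : u \in s -> far d u.
  move=> us; rewrite far_sym.
  by apply: arm_far hs us (subsetP (W_sub i) _ dW); rewrite eq_sym.
have BdR u : u \in v' :: D -> u = d \/ u \in r.
  move=> uB; have : u \in rcons r d by rewrite eq mem_cat in_cons uB !orbT.
  by rewrite mem_rcons in_cons => /predU1P[]; [left | right].
have seE u : u \in rcons s e -> u = e \/ u \in s.
  by rewrite mem_rcons in_cons => /predU1P[]; [left | right].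
exfalso.
(* The prism's paths are the edge from [x] to [c], the end of the arm from [v'] to [d], and the path
   from [v] through [a] up to [e]. *)
apply: (@no_prism _ x v' v c d e [:: x;
  c] (v' :: D) (v :: a :: A ++ rcons s e)).
- by [].
- by split; rewrite // sedge_sym.
- by [].
- split=> //; first by apply: contraNneq (xZ j) => ->.
  have /andP[] // : far v e.
  by apply: far_rs; rewrite // mem_rcons mem_head.
- by rewrite !mem_head.
- by split; rewrite ?inE ?mem_cat ?mem_rcons ?mem_head ?eqxx ?orbT //; move: dvB; mem_tac.
- split.
  + by apply: within_edge; rewrite ?inE ?eqxx ?orbT.
  + by apply: (@within_sorted _ _ (v' :: D)); rewrite ?mem_head //;
      [case/andP: soB | move: dvB; mem_tac].
  + apply: (@connect_trans _ _ a).
      by apply: (within_sorted soA); rewrite ?inE ?mem_rcons ?mem_head ?eqxx ?orbT //; sub_tac.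
    by apply: (within_sorted (arm_sorted hs));
      rewrite ?inE ?mem_rcons ?mem_head ?eqxx ?orbT //; sub_tac.
- move=> u w; rewrite in_cons mem_seq1 => /predU1P[-> | /eqP->].
    rewrite in_cons => /predU1P[-> | wD]; first by constructor 2.
    by constructor 1; apply: far_xD.
  by case/BdR => [-> | wr]; [constructor 3 | constructor 1; apply: far_cr].
- move=> u w; rewrite in_cons mem_seq1 => /predU1P[-> | /eqP->];
    rewrite !in_cons mem_cat => /or4P[/eqP-> | /eqP-> | wA | ws].
  + by constructor 2.
  + by constructor 1; rewrite /far xa sedge_sym.
  + by constructor 1; apply: far_xA.
  + by constructor 1; apply: far_xs.
  + by constructor 1; apply: far_cr.
  + constructor 1; rewrite /far sedge_sym xtrap // andbT.
    by apply: contraNneq (Z_a j) => <-.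
  + by constructor 1; apply: far_cr (Ar _ wA).
  + by case/seE: ws => [-> | ws]; [constructor 3 | constructor 1;
      apply: far_cs].
- move=> u w uB; rewrite !in_cons mem_cat => wH.
  have [ws | wA] : w \in rcons s e \/ w \in a :: rcons A v.
    by case/or4P: wH => wH; [right | right | right | left] => //;
      rewrite in_cons mem_rcons in_cons wH ?orbT.
    case/BdR: uB => [-> | ur]; last by constructor 1; apply: far_rs.
    by case/seE: ws => [-> | ws]; [constructor 3 | constructor 1;
      apply: far_ds].
  move: uB; rewrite in_cons => /predU1P[-> | uD]; last first.
    by constructor 1; rewrite far_sym; apply: gapAD.
  move: wA; rewrite -rcons_cons mem_rcons in_cons => /predU1P[-> | wA].
    by constructor 2.
  by constructor 1; rewrite far_sym; apply: gapAB; rewrite ?mem_head.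
Qed.

(* A theta with ends [b] and [a]. *)
Lemma root_far i j k p b q c s e r d x : i != j -> i != k -> j != k ->
    arm i p b -> arm j q c -> arm k s e -> arm i r d -> outside x ->
    x -- b -> has (sedge x) q -> misses x (rcons s e) -> misses x (rcons r d) ->
  misses b r.
Proof.
move=> ij ik jk hp hq hs hr xo xb /hasP[c' c'q xc'] xs xr u ur;
  apply/negP => bu.
have [xZ xa nax xtrap] := xo.
have bW := arm_root hp; have eW := arm_root hs.
have bZ := subsetP (W_sub i) _ bW.
apply: (@no_theta _ b a r (x :: q) (rcons s e)) => //.
- by apply: contraNneq (Z_a i) => <-.
- by rewrite sedge_sym xtrap.
- exact: connect_out (arm_sortedW hr) ur bu.
- apply: (connect_via (u := x)); rewrite ?inE ?eqxx ?orbT // 1?sedge_sym //.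
  apply: (connect_via (u := c')); rewrite ?inE ?eqxx ?c'q ?orbT //.
  by apply: (within_sorted (arm_sortedW hq)); rewrite ?inE ?c'q ?eqxx ?orbT //;
    sub_tac.
- apply: connect_out (arm_sorted hs) _ (W_complete ik bW eW).
  by rewrite mem_rcons mem_head.
- move=> v w vr; rewrite in_cons => /predU1P[-> | wq].
    rewrite far_sym; apply: far_out xo (arm_sub hr vr) _.
    by apply: xr; rewrite mem_rcons in_cons vr orbT.
  exact: arm_far ij hr vr (arm_sub hq wq).
- by move=> v w vr ws; apply: arm_far ik hr vr (arm_in hs ws).
- move=> v w; rewrite in_cons => /predU1P[-> | vq] ws.
    exact: far_out xo (arm_in hs ws) (xs _ ws).
  exact: arm_far jk hq vq (arm_in hs ws).
Qed.

Lemma attaches_has x s b : attaches x s b -> x -- b /\ has (sedge x) s.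
Proof.
case=> s' [b' [-> xb xb' _]]; split=> //; apply/hasP.
by exists b'; rewrite // mem_rcons mem_head.
Qed.

(** On an induced path the closed neighbourhood of the end [b] is [b] and its predecessor. The
    predecessor is not [a], since [x] and [a] have no common neighbour. *)
Lemma attaches_closed_nbhd i s b x : arm i s b -> outside x ->
    [set u in a :: rcons s b | x -- u] =
      [set u in a :: rcons s b | (u == b) || (b -- u)] ->
  attaches x s b.
Proof.
move=> h [_ _ _ xtrap] /setP eqN.
have nbr u : u \in rcons s b -> x -- u = (u == b) || b -- u.
  by move=> us; have := eqN u; rewrite !inE us orbT.
have xb : x -- b by rewrite nbr ?eqxx // mem_rcons mem_head.
case/lastP: s => [|s' b'] in h nbr {eqN} *.
  by have /andP[ab _] := arm_sorted h; rewrite (negPf (xtrap _ xb)) in ab.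
have [bb' farb] := arm_rcons h; exists s', b'; split=> //.
  by rewrite nbr ?bb' ?orbT // mem_rcons in_cons mem_rcons mem_head orbT.
move=> u us; rewrite nbr; last by rewrite mem_rcons in_cons mem_rcons in_cons us !orbT.
by have /andP[] := farb _ us; rewrite negb_or eq_sym => ->.
Qed.

(** The third path of the theta between the second vertices [b'] and [c'] goes down one arm to [a]
    and up the other. *)
Lemma both_attach i j p b q c x y : i != j -> arm i p b -> arm j q c ->
    outside x -> outside y -> attaches x p b -> attaches x q c ->
    attaches y p b -> attaches y q c -> x != y -> ~~ (x -- y) -> False.
Proof.
move=> ij hp hq xo yo [p' [b' [ep _ xb' xp']]] [q' [c' [eq _ xc' xq']]].
move=> [p2 [b2 [ep2 _ yb' yp']]] [q2 [c2 [eq2 _ yc' yq']]] xy nxy.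
(* Both jewels see the same second vertices, because these are determined by the arms. *)
move: ep2 eq2; rewrite ep eq => /rcons_inj[e1 e2] /rcons_inj[e3 e4].
rewrite -{}e1 -{}e2 -{}e3 -{}e4 in yb' yp' yc' yq'.
have pZ u : u \in rcons p' b' -> u \in Z i by rewrite -ep => /(arm_sub hp).
have qZ u : u \in rcons q' c' -> u \in Z j by rewrite -eq => /(arm_sub hq).
have mid v : outside v -> misses v p' -> misses v q' ->
    apart [:: v] (p' ++ a :: q').
  move=> vo vp vq u w; rewrite mem_seq1 => /eqP->.
  rewrite mem_cat in_cons => /or3P[wp | /eqP-> | wq].
  - by apply: far_out vo (pZ _ _) (vp _ wp); rewrite mem_rcons in_cons wp orbT.
  - by case: vo => _ va nav _; rewrite /far va sedge_sym.
  - by apply: far_out vo (qZ _ _) (vq _ wq); rewrite mem_rcons in_cons wq orbT.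
have bp : b' \in p by rewrite ep mem_rcons mem_head.
have cZ : c' \in Z j by apply: qZ; rewrite mem_rcons mem_head.
have /andP[bc nbc] := arm_far ij hp bp cZ.
have short v : v -- b' -> v -- c' -> connect (within [:: b', c' & [:: v]]) b' c'.
  move=> vb vc; apply: (connect_via (u := v)); rewrite ?inE ?eqxx ?orbT //.
    by rewrite sedge_sym.
  by apply: within_edge; rewrite ?inE ?eqxx ?orbT.
have sp := arm_sortedW hp; have sq := arm_sortedW hq; rewrite ep in sp;
  rewrite eq in sq.
apply: (@no_theta _ b' c' [:: x] [:: y] (p' ++ a :: q')) => //.
- exact: short.
- exact: short.
- apply: (@connect_trans _ _ a).
    by apply: (within_sorted sp); rewrite ?inE ?mem_rcons ?mem_head ?eqxx ?orbT //; sub_tac.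
  by apply: (within_sorted sq); rewrite ?inE ?mem_rcons ?mem_head ?eqxx ?orbT //; sub_tac.
- by move=> u w; rewrite !mem_seq1 => /eqP-> /eqP->; rewrite /far xy.
- exact: mid.
- exact: mid.
Qed.

(** Applied to arms without apex and root: it joins two arms of one edge by a connected set avoiding
    both [a] and the roots. *)
Definition touch s t : Prop :=
  exists u w, [/\ u \in s, w \in t & u = w \/ u -- w].

Lemma touch_connect i p b q c H u w : arm i p b -> arm i q c -> touch p q ->
  {subset p <= H} -> {subset q <= H} -> u \in p -> w \in q ->
  connect (within H) u w.
Proof.
move=> hp hq [v [v' [vp v'q vv']]] pH qH up wq.
have sp : sorted (@sedge G) p by have /path_sorted := arm_sortedW hp.
have sq : sorted (@sedge G) q by have /path_sorted := arm_sortedW hq.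
apply: (@connect_trans _ _ v); first exact: (within_sorted sp pH).
apply: (@connect_trans _ _ v'); last exact: (within_sorted sq qH).
case: vv' => [-> | vv']; first exact: connect0.
exact: within_edge (pH _ vp) (qH _ v'q) vv'.
Qed.

(** What a pyramid with a jewel provides. The third index is existential, as two jewels at one
    seagull may come from pyramids using different third edges. *)
Definition jewel_on x i j p b q c : Prop :=
  [/\ outside x, arm i p b /\ attaches x p b, arm j q c /\ attaches x q c &
     exists k s e, [/\ i != k, j != k, arm k s e & misses x (rcons s e)]].

Lemma jewel_on_sym x i j p b q c : jewel_on x i j p b q c -> jewel_on x j i q c p b.
Proof. by case=> xo hp hq [k [s [e [ik jk hs xs]]]]; split=> //;
  exists k, s, e. Qed.

Lemma jewel_on_split x i j p b q c r d : i != j -> jewel_on x i j p b q c ->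
  arm i r d -> misses x (rcons r d) \/ attaches x r d.
Proof.
move=> ij [xo _ [hq /attaches_has[xc xq]] [k [s [e [ik jk hs xs]]]]] hr.
exact: attach_or_miss ij ik jk hr hq hs xo xc xq xs.
Qed.

Lemma split_jewels i j x p b q c y p2 b2 q2 c2 : i != j ->
    jewel_on x i j p b q c -> jewel_on y i j p2 b2 q2 c2 ->
    misses x (rcons p2 b2) -> misses y (rcons p b) ->
    touch p p2 -> touch q q2 -> x != y -> ~~ (x -- y) -> False.
Proof.
move=> ij [xo [hp axp] [hq axq] [k [s [e [ik jk hs xs]]]]].
move=> [yo [hp2 ayp] [hq2 ayq] [k2 [s2 [e2 [ik2 jk2 hs2 ys2]]]]].
move=> xp2 yp tp tq xy nxy.
have [xb hxp] := attaches_has axp; have [_ hxq] := attaches_has axq.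
have [yb hyp] := attaches_has ayp; have [_ hyq] := attaches_has ayq.
(* The third arm comes from the pyramid of [x]; that [y] misses it as well has to be derived. *)
have ys := miss_third ij ik jk hp2 hq2 hs yo hyp hyq.
have bp2 := root_far ij ik jk hp hq hs hp2 xo xb hxq xs xp2.
have bp := root_far ij ik2 jk2 hp2 hq2 hs2 hp yo yb hyq ys2 yp.
have [p' [b' [ep _ xb' xp']]] := axp; have [p2' [b2' [ep2 _ yb' yp']]] := ayp.
have [c' c'q xc'] := hasP hxq; have [c2' c2'q yc'] := hasP hyq.
have bW := arm_root hp; have bW2 := arm_root hp2; have eW := arm_root hs.
have bZ := subsetP (W_sub i) _ bW; have bZ2 := subsetP (W_sub i) _ bW2.
have eZ := subsetP (W_sub k) _ eW.
have b'p : b' \in p by rewrite ep mem_rcons mem_head.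
have b2'p : b2' \in p2 by rewrite ep2 mem_rcons mem_head.
have xb2 : ~~ (x -- b2) by apply: xp2; rewrite mem_rcons mem_head.
have yb1 : ~~ (y -- b) by apply: yp; rewrite mem_rcons mem_head.
have xe : ~~ (x -- e) by apply: xs; rewrite mem_rcons mem_head.
have ye : ~~ (y -- e) by apply: ys; rewrite mem_rcons mem_head.
have xpp2 u : u \in p2 -> far x u.
  move=> up; apply: far_out xo (arm_sub hp2 up) _.
  by apply: xp2; rewrite mem_rcons in_cons up orbT.
have ypp u : u \in p -> far y u.
  move=> up; apply: far_out yo (arm_sub hp up) _.
  by apply: yp; rewrite mem_rcons in_cons up orbT.
have xpE u : u \in p -> far x u \/ u = b'.
  move=> up; have := up; rewrite ep mem_rcons in_cons => /predU1P[-> | up'].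
    by right.
  by left; apply: far_out xo (arm_sub hp up) (xp' _ up').
have ypE u : u \in p2 -> far y u \/ u = b2'.
  move=> up; have := up; rewrite ep2 mem_rcons in_cons => /predU1P[-> | up'].
    by right.
  by left; apply: far_out yo (arm_sub hp2 up) (yp' _ up').
have [bb' bp'] : b -- b' /\ {in p', forall u, far b u}.
  by apply: (@arm_rcons i); rewrite -ep.
have [b2b2' bp2'] : b2 -- b2' /\ {in p2', forall u, far b2 u}.
  by apply: (@arm_rcons i); rewrite -ep2.
have bpE u : u \in p -> far b u \/ u = b'.
  by rewrite ep mem_rcons in_cons => /predU1P[-> | /bp']; [right | left].
have b2pE u : u \in p2 -> far b2 u \/ u = b2'.
  by rewrite ep2 mem_rcons in_cons => /predU1P[-> | /bp2']; [right | left].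
have offW v u r d : v \in W i -> arm i r d -> u \in r -> v != u.
  by move=> vW hr ur; apply: contraNneq (arm_off hr ur) => <-.
have far_bp2 u : u \in p2 -> far b u.
  by move=> up; rewrite /far (offW _ _ _ _ bW hp2 up) bp2.
have far_b2p u : u \in p -> far b2 u.
  by move=> up; rewrite /far (offW _ _ _ _ bW2 hp up) bp.
have qZ u : u \in q ++ q2 -> forall l v, j != l -> v \in Z l -> far u v.
  rewrite mem_cat => /orP[uq | uq] l v jl vZ.
    exact: arm_far jl hq uq vZ.
  exact: arm_far jl hq2 uq vZ.
have pZ u : u \in p ++ p2 -> u \in Z i /\ far e u.
  rewrite mem_cat => /orP[up | up].
    by rewrite (arm_sub hp up) far_sym; split=> //; apply: arm_far ik hp up eZ.
  by rewrite (arm_sub hp2 up) far_sym; split=> //; apply: arm_far ik hp2 up eZ.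
have be : b -- e by apply: (W_complete ik).
have eb2 : e -- b2 by rewrite sedge_sym; apply: (W_complete ik).
(* One path of the prism consists of roots only: [b] and [b2] both lie in [W i] and may be
   non-adjacent, but [e] sees both. *)
have [B [bB b2B cB BE]] : exists B, [/\ b \in B, b2 \in B,
    connect (within B) b b2 & forall u, u \in B -> [\/ u = b, u = b2 | u = e]].
  have [bb2 | _] := boolP (b -- b2).
    exists [:: b; b2]; rewrite !inE !eqxx orbT; split=> //.
      by apply: within_edge; rewrite ?inE ?eqxx ?orbT.
    by move=> u; rewrite !inE => /orP[/eqP-> | /eqP->]; [constructor 1 | constructor 2].
  exists [:: b; b2; e]; rewrite !inE !eqxx !orbT; split=> //.
    apply: (connect_via (u := e)); rewrite ?inE ?eqxx ?orbT //.
    by apply: within_edge; rewrite ?inE ?eqxx ?orbT.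
  by move=> u; rewrite !inE => /or3P[] /eqP->; [constructor 1 | constructor 2 | constructor 3].
(* From [x] to [y] the path uses the arms of [j], from [b'] to [b2'] those of [i]; each union is
   connected because the arms touch. *)
apply: (@no_prism _ x b b' y b2 b2' (x :: y :: q ++ q2) B (p ++ p2)) => //.
- split=> //; first by apply: contraNneq xb2 => <-.
  by apply: contraTneq xb' => ->; have /andP[] := xpp2 _ b2'p.
- by rewrite mem_head mem_cat b'p.
- by rewrite !inE eqxx orbT mem_cat b2'p orbT.
- split=> //.
    apply: (connect_via (u := c')); rewrite ?inE ?mem_cat ?c'q ?eqxx ?orbT //.
    rewrite within_sym; apply: (connect_via (u := c2'));
      rewrite ?inE ?mem_cat ?c2'q ?eqxx ?orbT //.
    by rewrite within_sym; apply: touch_connect hq hq2 tq _ _ c'q c2'q; sub_tac.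
  by apply: touch_connect hp hp2 tp _ _ b'p b2'p; sub_tac.
- move=> u w; rewrite !in_cons => /or3P[/eqP-> | /eqP-> | uq] /BE[]->.
  + by constructor 2.
  + by constructor 1; apply: far_out xo bZ2 xb2.
  + by constructor 1; apply: far_out xo eZ xe.
  + by constructor 1; apply: far_out yo bZ yb1.
  + by constructor 3.
  + by constructor 1; apply: far_out yo eZ ye.
  + by constructor 1; apply: qZ bZ; rewrite // eq_sym.
  + by constructor 1; apply: qZ bZ2; rewrite // eq_sym.
  + by constructor 1; apply: qZ eZ.
- move=> u w uH wP; have [wZ _] := pZ _ wP.
  move: uH; rewrite !in_cons => /or3P[/eqP-> | /eqP-> | uq].
  + move: wP; rewrite mem_cat => /orP[/xpE[?|->] | /xpp2 ?];
      first by constructor 1.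
      by constructor 2.
    by constructor 1.
  + move: wP; rewrite mem_cat => /orP[/ypp ? | /ypE[?|->]];
      first by constructor 1.
      by constructor 1.
    by constructor 3.
  + by constructor 1; apply: qZ wZ; rewrite // eq_sym.
- move=> u w /BE[]-> wP; have [wZ ew] := pZ _ wP; last by constructor 1.
    move: wP; rewrite mem_cat => /orP[/bpE[?|->] | /far_bp2 ?];
      first by constructor 1.
      by constructor 2.
    by constructor 1.
  move: wP; rewrite mem_cat => /orP[/far_b2p ? | /b2pE[?|->]];
    first by constructor 1.
    by constructor 1.
  by constructor 3.
Qed.

Lemma jewels_adjacent i j x p b q c y p2 b2 q2 c2 : i != j ->
    jewel_on x i j p b q c -> jewel_on y i j p2 b2 q2 c2 ->
    touch p p2 -> touch q q2 -> x != y -> x -- y.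
Proof.
move=> ij jx jy tp tq xy; apply/negPn/negP => nxy.
have ji : j != i by rewrite eq_sym.
have jx' := jewel_on_sym jx; have jy' := jewel_on_sym jy.
have [xo [hp axp] [hq axq] _] := jx; have [yo [hp2 ayp] [hq2 ayq] _] := jy.
(* Each jewel attaches to or misses the other's arm. Unless both miss, one of the two arms is
   common; both missing is excluded by [split_jewels]. *)
have shared l r d r2 d2 : arm l r d -> arm l r2 d2 ->
    attaches x r d -> attaches y r2 d2 ->
    misses x (rcons r2 d2) \/ attaches x r2 d2 ->
    misses y (rcons r d) \/ attaches y r d ->
    ~ (misses x (rcons r2 d2) /\ misses y (rcons r d)) ->
  exists r' d', [/\ arm l r' d', attaches x r' d' & attaches y r' d'].
  move=> hr hr2 ax ay [mx | ax'] [my | ay'] nm.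
  - by case: nm.
  - by exists r, d.
  - by exists r2, d2.
  - by exists r2, d2.
have [|r [d [hr xr yr]]] := shared i p b p2 b2 hp hp2 axp ayp
  (jewel_on_split ij jx hp2) (jewel_on_split ij jy hp).
  by case=> mx my; apply: (split_jewels ij jx jy mx my).
have [|r' [d' [hr' xr' yr']]] := shared j q c q2 c2 hq hq2 axq ayq
  (jewel_on_split ji jx' hq2) (jewel_on_split ji jy' hq).
  by case=> mx my; apply: (split_jewels ji jx' jy' mx my).
exact: both_attach ij hr hr' xo yo xr xr' yr yr' xy nxy.
Qed.
End Arms.

(** * Ramsey numbers and counting *)

Lemma clique_sub (G : sgraph) (K : {set G}) n : clique K -> n <= #|K| ->
  exists2 K' : {set G}, #|K'| = n & clique K'.
Proof.
move=> cK /card_geqP[s [us ss sK]]; exists [set x in s].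
  by rewrite cardsE (card_uniqP us).
by move=> x y; rewrite !inE => /sK xK /sK yK; apply: cK.
Qed.

(** A crude bound, enough for the Ramsey number to exist. More than [t] non-neighbours of a vertex
    [v] form a clique or contain two that are stable with [v]; otherwise [v] has at least [t * t]
    neighbours, and induction applies to them. *)
Lemma ramsey3_in t (G : sgraph) (H : {set G}) : t * t <= #|H| ->
  (exists K : {set G}, [/\ K \subset H, #|K| = t & clique K]) \/
  (exists K : {set G}, #|K| = 3 /\ stable K).
Proof.
elim: t H => [|t IHt] H tH.
  left; exists set0; rewrite sub0set cards0; split=> //.
  by move=> x y; rewrite inE.
have /card_gt0P[v vH] : 0 < #|H| by apply: leq_trans tH.
pose N := [set x in H | v -- x]; pose M := [set x in H :\ v | ~~ (v -- x)].
have [tM | Mt] := leqP t.+1 #|M|.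
  have [[x [y [xM yM xy nxy]]] | cM] :=
    pselect (exists x y, [/\ x \in M, y \in M, x != y & ~~ (x -- y)]).
    right; exists [set v; x; y]; move: xM yM; rewrite !inE.
    case/andP=> /andP[xv _] vx /andP[/andP[yv _] vy]; split.
      rewrite -setUA cardsU1 !inE cards2 xy negb_or.
      by rewrite eq_sym xv eq_sym yv.
    have [xv' yv' yx'] : [/\ ~~ (x -- v), ~~ (y -- v) & ~~ (y -- x)].
      by split; rewrite sedge_sym.
    by move=> u w; rewrite !inE => /orP[/orP[]|] /eqP-> /orP[/orP[]|] /eqP->;
      rewrite ?sedge_irr.
  have cliqueM : clique M.
    by move=> x y xM yM xy; apply/negPn/negP => nxy; case: cM; exists x, y.
  have /card_geqP[s [us ss sM]] := tM.
  left; exists [set x in s]; rewrite cardsE (card_uniqP us); split=> //.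
    by apply/subsetP => x; rewrite inE => /sM; rewrite !inE => /andP[/andP[]].
  by move=> x y; rewrite !inE => /sM xM /sM yM; apply: cliqueM.
have cardH : #|H| = (#|N| + #|M|).+1.
  rewrite (cardsD1 v) vH add1n; congr _.+1.
  rewrite -(cardsID [set x | v -- x] (H :\ v)); congr (_ + _);
    apply: eq_card => x.
    rewrite !inE; case: (x =P v) => [-> | _] /=;
      first by rewrite sedge_irr !andbF.
    by [].
  by rewrite !inE andbC.
have tN : t * t <= #|N|.
  rewrite cardH mulSn mulnS addnA addSn ltnS in tH.
  rewrite -(leq_add2r t); apply: leq_trans (leq_trans tH _); last first.
    by rewrite leq_add2l.
  by rewrite addnC leq_add2r leq_addl.
have [[K [KN cK qK]] | ?] := IHt N tN; last by right.
left; exists (v |: K); split.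
- apply/subsetP => x; rewrite !inE => /predU1P[-> // | /(subsetP KN)].
  by rewrite inE => /andP[].
- rewrite cardsU1 cK; case: (boolP (v \in K)) => [/(subsetP KN)|_ //].
  by rewrite inE sedge_irr andbF.
have vK x : x \in K -> v -- x by move/(subsetP KN); rewrite inE => /andP[].
move=> x y; rewrite !inE => /predU1P[-> | xK] /predU1P[-> | yK] xy.
- by rewrite eqxx in xy.
- exact: vK.
- by rewrite sedge_sym vK.
- exact: qK.
Qed.

Lemma ramsey_number3 t : exists r, is_ramsey_number t 3 r.
Proof.
have ex : exists n, `[< ramsey_property t 3 n >].
  exists (t * t); apply/asboolP => G tG.
  have [||] := @ramsey3_in t G setT; first by rewrite cardsT.
    by case=> K [_ ? ?]; left; exists K.
  by right.
exists (ex_minn ex); case: ex_minnP => r /asboolP Rr rmin; split=> // n Rn.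
by apply: rmin; apply/asboolP.
Qed.

Lemma complete_sym n : symmetric [rel x y : 'I_n | x != y].
Proof. by move=> x y; rewrite /= eq_sym. Qed.

Lemma complete_irr n : irreflexive [rel x y : 'I_n | x != y].
Proof. by move=> x; rewrite /= eqxx. Qed.

(** Tested on the complete graph with [r] vertices, which has no stable set of size three. *)
Lemma ramsey_ge t r : ramsey_property t 3 r -> t <= r.
Proof.
move=> /(_ (SGraph (@complete_sym r) (@complete_irr r))).
rewrite /= card_ord leqnn => /(_ isT)[[K [cK _]] | [K [cK sK]]].
  by rewrite -cK; apply: leq_trans (max_card _) _; rewrite card_ord.
have /card_gt1P[x [y [xK yK xy]]] : 1 < #|K| by rewrite cK.
by have /= := sK x y xK yK; rewrite xy.
Qed.

Lemma card_bigcup_le (I T : finType) (P : pred I) (F : I -> {set T}) n :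
  (forall i, P i -> #|F i| <= n) -> #|\bigcup_(i | P i) F i| <= #|P| * n.
Proof.
move=> Fn; rewrite -sum_nat_const.
apply: (@leq_trans (\sum_(i | P i) #|F i|)); last exact: leq_sum.
apply: (big_ind2 (fun (A : {set T}) m => #|A| <= m)) => [|A m B k Am Bk|//].
  by rewrite cards0.
exact: leq_trans (leq_card_setU A B) (leq_add Am Bk).
Qed.

(** If all vertices were leaves, a vertex and its neighbour would be closed under adjacency and
    exhaust the connected tree. This makes ['C(delta, 2)] positive, as the strict bound requires. *)
Lemma smooth_max_degree (T : sgraph) : T -> tree T -> smooth T -> 1 < max_degree T.
Proof.
move=> v [conT _] [cT smT].
have degT (w : T) : degree w <= max_degree T := leq_bigmax w.
have [lv | dv] := smT v; last exact: leq_trans (ltnW dv) (degT v).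
rewrite ltnNge; apply/negP => dT.
have leafT (w : T) : leaf w.
  by have [//|] := smT w; rewrite ltnNge (leq_trans (degT w)) // (leq_trans dT).
have nbr1 (x y w : T) : x -- y -> x -- w -> w = y.
  have /cards1P[u Nu] := leafT x.
  have uniq_nbr y' : x -- y' -> y' = u.
    by move=> xy'; apply/eqP; rewrite -in_set1 -Nu !inE.
  by move=> /uniq_nbr-> /uniq_nbr->.
have /cards1P[u Nu] := lv.
have vu : v -- u by have := set11 u; rewrite -Nu !inE.
have cl : closed (@sedge T) [set v; u].
  apply: intro_closed => [|x y xy].
    by apply: sym_connect_sym; apply: sedge_sym.
  rewrite !inE => /orP[] /eqP xE; rewrite {x}xE in xy.
    by rewrite (nbr1 _ _ _ vu xy) eqxx orbT.
  by rewrite sedge_sym in vu; rewrite (nbr1 _ _ _ vu xy) eqxx.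
have sT : [set: T] \subset [set v; u].
  by apply/subsetP => w _; rewrite -(closed_connect cl (conT v w)) !inE eqxx.
by have := subset_leq_card sT; rewrite cardsT cards2 => /(leq_trans cT);
  case: (v != u).
Qed.

(** * Arms of a strip structure *)

Section StripArms.
Variables (G T : sgraph) (a : G) (z : strip T G) (v : T).
Hypotheses (treeT : tree T) (stripz : strip_structure z a) (richz : rich z a).
Implicit Types (e f g h : edge T) (u w l : T).

Definition side e : {set T} := [set w | ~~ connect (del_edge e) v w].

(** The zone is empty for edges not at [v], so separation holds for all pairs of distinct edges. The
    sets [sv] are left out because arms live in edge strips. *)
Definition zone e : {set G} :=
  \bigcup_(f : edge T | (v \in val e) && (val f \subset v |: side e)) se z f.

Lemma edge_end e u : u \in val e -> exists2 w, u -- w & val e = [set u; w].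
Proof.
have /existsP[x /existsP[y /andP[xy /eqP ->]]] := valP e.
rewrite !inE => /orP[] /eqP->; first by exists y.
by exists x; rewrite 1?setUC // sedge_sym.
Qed.

Lemma del_edge_sym e : connect_sym (del_edge e).
Proof. by apply: sym_connect_sym => x y;
  rewrite /del_edge /= sedge_sym setUC. Qed.

Lemma del_edge_avoid e u p : v \in val e -> path (@sedge T) u p -> v \notin u :: p ->
  path (del_edge e) u p.
Proof.
move=> ve; elim: p u => //= w p IHp u /andP[uw pw].
rewrite in_cons negb_or => /andP[vu vp]; rewrite IHp // andbT.
rewrite /del_edge /= uw; apply: contraNneq vp => eq.
by move: ve; rewrite -[val e]/(sval e) -eq !inE (negPf vu) /= => /eqP->;
  apply: mem_head.
Qed.

Lemma connect_first e u p : v \in val e -> path (@sedge T) v (u :: p) ->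
  uniq (v :: u :: p) -> [set v; u] != val e ->
  {in u :: p, forall w, connect (del_edge e) v w}.
Proof.
move=> ve /= /andP[vu pu] /andP[vp _] ne w wp.
apply: (path_connect (p := u :: p)); last by rewrite /= in_cons wp orbT.
by rewrite /= {1}/del_edge /= vu ne del_edge_avoid.
Qed.

(** A simple path from [v] uses at most its first edge among the edges at [v]. To reach [w] in the
    side of [e] that edge must be [e], so the path survives deleting [f]. *)
Lemma side_disjoint e f w : e != f -> v \in val e -> v \in val f ->
  w \in side e -> w \notin side f.
Proof.
move=> ef ve vf; rewrite !inE negbK => we.
have /connectP[p0 /shortenP[p pv up _] {p0} wE] := treeT.1 v w.
case: p => [|u p] in pv up wE; first by rewrite wE connect0.
have wp : w \in u :: p by rewrite wE; apply: (mem_last u p).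
have [ue | ne] := eqVneq [set v; u] (val e); last first.
  by rewrite (connect_first ve pv up ne wp) in we.
by apply: connect_first wp; rewrite // ue val_eqE.
Qed.

(** A path from [v] to [u] avoiding [e] would close up with [e] to a cycle. *)
Lemma edge_side e u : val e = [set v; u] -> v -- u -> u \in side e.
Proof.
move=> ee vu; rewrite inE; apply/negP => /connectP[p0 /shortenP[p pv up _] {p0} uE].
have sub x q : path (del_edge e) x q -> path (@sedge T) x q.
  by apply: sub_path => x' y /andP[].
case: p => [|w [|w' p]] in pv up uE.
- by rewrite uE sedge_irr in vu.
- by rewrite /= in uE; move: pv; rewrite /= -uE /del_edge /= ee eqxx andbF.
apply: (negP (treeT.2 (v :: w :: w' :: p) isT)); rewrite /ucycleb up andbT.
rewrite (cycle_path v) (_ : last v _ = u) /= 1?sedge_sym ?vu;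
  last by rewrite uE.
exact: sub pv.
Qed.

Lemma val_edge_sub e : v \in val e -> val e \subset v |: side e.
Proof.
move=> ve; have [u vu ee] := edge_end ve.
by rewrite {1}ee subUset !sub1set setU11 in_setU1 (edge_side ee vu) orbT.
Qed.

Lemma edge_in_side e f : v \in val e -> v \in val f -> val f \subset v |: side e ->
  f = e.
Proof.
move=> ve vf fe; apply/eqP/negPn/negP => ef.
have [u vu fE] := edge_end vf.
have us : u \in side e.
  have := subsetP fe u; rewrite fE set22 in_setU1 => /(_ isT)/predU1P[uv|//].
  by rewrite uv sedge_irr in vu.
by have := side_disjoint ef vf ve (edge_side fE vu); rewrite us.
Qed.

Lemma sub_sides e f h : e != f -> v \in val e -> v \in val f ->
  val h \subset v |: side e -> val h \subset v |: side f -> False.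
Proof.
move=> ef ve vf /subsetP he /subsetP hf.
have hv u : u \in val h -> u = v.
  move=> uh; have := he _ uh; rewrite in_setU1 => /predU1P[// | ue].
  have := hf _ uh; rewrite in_setU1 => /predU1P[// | uf].
  by have := side_disjoint ef ve vf ue; rewrite uf.
have /existsP[x /existsP[y /andP[xy /eqP hE]]] := valP h.
have := hv x; have := hv y; rewrite hE !inE !eqxx orbT => /(_ isT) yv /(_ isT) xv.
by rewrite xv yv sedge_irr in xy.
Qed.

Lemma root_at e x : x \in sev z e v -> v \in val e.
Proof. by move=> xe; apply/(S3_inc stripz); apply/set0Pn; exists x. Qed.

Lemma zone_a e : a \notin zone e.
Proof. by apply/bigcupP => -[f _];
  rewrite (negPf (strip_avoids_e stripz f)). Qed.

Lemma root_sub e : sev z e v \subset zone e.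
Proof.
apply/subsetP => x xe; have ve := root_at xe; apply/bigcupP; exists e.
  by rewrite ve val_edge_sub.
exact: subsetP (S3_sub stripz e v) _ xe.
Qed.

(** Edges between two strips occur only at a common tree vertex. The two sides share only [v] once
    it is added to both, and a strip behind [e] that contains [v] is that of [e]. *)
Lemma zone_sep e f x y : e != f -> x \in zone e -> y \in zone f ->
  far x y \/ (x \in sev z e v /\ y \in sev z f v).
Proof.
move=> ef /bigcupP[g /andP[ve ge] xg] /bigcupP[h /andP[vf hf] yh].
have gh : g != h by apply: contraTneq ge => ->; apply/negP => /sub_sides; apply;
  eauto.
have xy : x != y.
  apply: contraTneq xg => ->; have := S1_ee stripz gh.
  by rewrite disjoint_sym => /disjointFr->.
have [exy | nxy] := boolP (x -- y); last by left; rewrite /far xy.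
right; have [w [xw yw]] := S4_only stripz gh xg yh exy.
have wg : w \in val g by apply/(S3_inc stripz); apply/set0Pn; exists x.
have wh : w \in val h by apply/(S3_inc stripz); apply/set0Pn; exists y.
have wv : w = v.
  have := subsetP ge _ wg; rewrite in_setU1 => /predU1P[// | we].
  have := subsetP hf _ wh; rewrite in_setU1 => /predU1P[// | wf].
  by have := side_disjoint ef ve vf we; rewrite wf.
rewrite {w}wv in xw yw wg wh.
by rewrite -(edge_in_side ve wg ge) -(edge_in_side vf wh hf).
Qed.

Lemma root_complete e f : e != f -> complete (sev z e v) (sev z f v).
Proof. exact: (S4_complete stripz). Qed.

Lemma jewel_outside x : x \notin zeta_plus z a -> outside a zone x.
Proof.
move=> xz; have [[near _] _] := richz; split.
- move=> e; apply: contra xz => /bigcupP[f _ xf]; rewrite !inE; apply/orP;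
    right.
  by apply/orP; right; apply/bigcupP; exists f; rewrite ?subsetT.
- by apply: contraNneq xz => ->; rewrite !inE eqxx.
- apply: contra xz => ax; apply: near; exists [:: x]; split=> //=.
  by rewrite ax.
- move=> u xu; apply: contra xz => au; apply: near; exists [:: u; x];
    split=> //=.
  by rewrite au sedge_sym xu.
Qed.

(** * Arms cut out of pyramids *)

Notation arm := (arm a zone (fun e => sev z e v)).

(* [y] is the far end of the rung in e; unless its strip ends at a leaf, the arm
   goes on through another strip at [u].  This makes any two arms meet away
   from [a]. *)
Definition reaches e (s : seq G) : Prop :=
  exists u y, [/\ val e = [set v; u], y \in s, y \in sev z e u &
    leaf u \/ exists f (x : G), [/\ f != e, x \in s & x \in sev z f u]].

(** At a leaf, richness leaves a single vertex that both lists contain. At an inner vertex, the far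
    end of one rung is adjacent to the vertex of the next strip on the other list. *)
Lemma reaches_touch e s t : reaches e s -> reaches e t -> touch s t.
Proof.
move=> [u [y [eE ys yu _]]] [u' [y' [eE' y't y'u next]]].
have uu : u' = u.
  have [vu uv] : u' \in val e /\ u \in val e.
    by rewrite {1}eE' eE !inE !eqxx !orbT.
  have card2 : #|val e| = 2.
    have /existsP[x1 /existsP[x2 /andP[x12 /eqP ->]]] := valP e.
    by rewrite cards2; case: eqP x12 => // ->; rewrite sedge_irr.
  have u'v : u' != v.
    by apply: contraPneq card2 => u'v; rewrite eE' u'v setUid cards1.
  by move: vu; rewrite eE !inE (negPf u'v) => /eqP.
rewrite {u'}uu in eE' y'u next.
have ue : u \in val e by rewrite eE !inE eqxx orbT.
case: next => [lu | [f [g [fe gt gu]]]].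
  exists y, y'; split=> //; left.
  have /eqP/cards1P[x xE] := richz.2 u e lu ue.
  by move: yu y'u; rewrite xE !inE => /eqP-> /eqP->.
by exists y, g; split=> //; right; apply: (S4_complete stripz _ yu gu);
  rewrite eq_sym.
Qed.

Lemma rung_end f (R : {set G}) u : rung z f R -> u \in val f ->
  exists2 y, y \in R & y \in sev z f u.
Proof.
move=> [u1 [u2 [fE rf]]]; rewrite fE !inE => uf.
case: rf => [[/eqP/cards1P[x ->]] | [x [y [p [[-> _] [[pn _ _ _] hp lp] x1 y2 _]]]]].
  rewrite subsetI !sub1set => /andP[x1 x2]; exists x; rewrite ?set11 //.
  by case/orP: uf => /eqP->.
move: x1 y2; rewrite !inE => /andP[_ x1] /andP[_ y2].
have [xp yp] : x \in p /\ y \in p.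
  by case: p pn hp lp => //= k p _ <- <-; rewrite mem_head mem_last.
by case/orP: uf => /eqP->; [exists x | exists y]; rewrite ?inE.
Qed.

(** Two vertices rule out the degenerate rung, so the far end avoids [sev z e v] and cannot be the
    root of the arm. *)
Lemma long_rung_end e u (R : {set G}) : long_rung z e R -> val e = [set v; u] ->
  v != u -> exists2 y, y \in R & y \in sev z e u :\: sev z e v.
Proof.
move=> [[u1 [u2 [eE rf]]] big] eE' vu.
case: rf => [[c1 _] | [x [y [p [[RE _] [[pn _ _ _] hp lp] x1 y2 _]]]]].
  by rewrite c1 in big.
have [xp yp] : x \in p /\ y \in p.
  by case: p pn hp lp {RE} => //= k p _ <- <-; rewrite mem_head mem_last.
have [/eqP v1 | v1] := boolP (v == u1).
  have u2u : u2 = u.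
    have : u \in val e by rewrite eE' !inE eqxx orbT.
    by rewrite eE !inE -v1 eq_sym (negPf vu) => /eqP.
  by exists y; rewrite ?RE ?inE // -u2u v1 -in_setD.
have v2 : u2 = v.
  have : v \in val e by rewrite eE' !inE eqxx.
  by rewrite eE !inE (negPf v1) => /eqP.
have u1u : u1 = u.
  have : u1 \in val e by rewrite eE !inE eqxx.
  by rewrite eE' !inE eq_sym (negPf v1) => /eqP.
by exists x; rewrite ?RE ?inE // -u1u -v2 -in_setD.
Qed.

Lemma pyramid_arm (e : 'I_3 -> edge T) b Gam i : zeta_pyramid z a v e b Gam ->
  exists s, [/\ Gam i = rcons s (b i), arm (e i) s (b i) & reaches (e i) s].
Proof.
move=> [[inje ve] [tri pb disj between _] bW legs].
have [l [Lam [[leafl ncon] pathL [[Gne uG _ _] subG] long rungs]]] := legs i.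
case: pathL => [[Lne uL sL indL] hL lL].
have [[pathG hG lG] _] := pb i.
case/lastP E : (Gam i) Gne => [//|s c] _.
have cb : c = b i by rewrite -lG E /= last_rcons.
rewrite cb in E; exists s.
have vi := ve i.
case: Lam Lne hL lL uL sL subG rungs {indL} => //= v' Lam _ -> lL uL sL subG rungs.
case: Lam lL uL sL subG rungs => [|u Lam] /= lL uL sL subG rungs.
  by rewrite lL connect0 in ncon.
(* The path [Lam] ends beyond [e i], so its first edge is [e i]. *)
have eE : val (e i) = [set v; u].
  apply/esym/eqP/negPn/negP => ne.
  by rewrite -lL (connect_first vi sL uL ne) ?mem_last in ncon.
have vu : v -- u by case/andP: sL.
have vnu : v != u by apply: contraTneq vu => <-; rewrite sedge_irr.
have Lside : {subset [set w in [:: v, u & Lam]] <= v |: side (e i)}.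
  move=> w; rewrite inE in_cons => /predU1P[-> | wL]; first by rewrite setU11.
  rewrite in_setU1 inE; apply/orP; right; apply: contra ncon => vw.
  apply: connect_trans vw _.
  have avoid : path (del_edge (e i)) u Lam.
    by apply: del_edge_avoid => //; [case/andP: sL | case/andP: uL].
  apply: (@connect_trans _ _ u).
    by rewrite del_edge_sym; apply: path_connect avoid _ wL.
  by rewrite -lL; apply: path_connect avoid _ (mem_last _ _).
have GZ x : x \in Gam i -> x \in zone (e i).
  rewrite -[x \in _](in_set (mem (Gam i))) => /(subsetP subG)/bigcupP[f fL xf].
  by apply/bigcupP; exists f; rewrite // vi (subset_trans fL) //; apply/subsetP.
have aZ x : x \in Gam i -> x != a.
  by move=> /GZ xz; apply: contraNneq (zone_a (e i)) => <-.
have sG x : x \in s -> x \in Gam i by move=> xs;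
  rewrite E mem_rcons in_cons xs orbT.
have bs : b i \notin s by move: uG; rewrite E rcons_uniq => /andP[].
have bG : b i \in Gam i by rewrite E mem_rcons mem_head.
have sb x : x \in Gam i -> x != b i -> x \in s.
  by rewrite E mem_rcons in_cons => /predU1P[-> | //]; rewrite eqxx.
split; first by rewrite cb.
  apply: Arm => [|x /sG/GZ //||x xs]; first by rewrite -E.
    exact: bW.
    (* A second vertex of the leg in this set would be adjacent to the base vertex of another leg,
       which a pyramid forbids. *)
    apply/negP => xW.
    pose j : 'I_3 := if i == ord0 then ord_max else ord0.
    have ij : i != j by rewrite /j; case: ifP => [/eqP-> | ->].
    have xb : x -- b j.
      by apply: (S4_complete stripz (e := e i) (f := e j)) xW (bW j);
        rewrite inj_eq.
    have bj : b j \in [set w in a :: Gam j] :\ a.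
      have [[_ _ lj] _] := pb j; rewrite in_setD1 inE -[X in X \in a :: _]lj.
      rewrite (mem_last a (Gam j)) andbT.
      by apply: contraNneq (strip_avoids_ev stripz (e j) v) => <-; apply: bW.
    have xi : x \in [set w in a :: Gam i] :\ a.
      by rewrite in_setD1 inE in_cons (sG _ xs) orbT aZ ?sG.
    have [xbi _] := between i j x (b j) ij xi bj xb.
    by rewrite -xbi xs in bs.
have [y yR] := long_rung_end long eE vnu; rewrite in_setD => /andP[ynv yu].
move: yR; rewrite in_setI inE => /andP[yG _].
exists u, y; split=> //; first by apply: sb => //; apply: contraNneq ynv => ->;
  apply: bW.
(* Either [u] is the leaf ending [Lam], or the rung in the next edge [u w] supplies a vertex of the
   next strip at [u]. *)
case: Lam lL uL sL {subG} rungs {Lside} => [|w Lam] /= lL uL sL rungs.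
  by left; rewrite lL.
right; have uw : u -- w by case/and3P: sL.
have fP : is_edge [set u; w].
  by apply/existsP; exists u; apply/existsP; exists w; rewrite uw eqxx.
pose f : edge T := exist _ [set u; w] fP.
have vf : v \notin val f.
  move: uL; rewrite /= !in_cons !negb_or => /andP[/and3P[v1 v2 _] _].
  by rewrite !inE negb_or v1.
have fe : f != e i by apply: contraNneq vf => ->.
have fL : val f \subset [set x in [:: v, u, w & Lam]].
  by rewrite subUset !sub1set !inE !eqxx !orbT.
have uf : u \in val f by rewrite set21.
have [x] := rung_end (rungs f fL fe) uf; rewrite in_setI inE => /andP[xG xf] xu.
exists f, x; split=> //; apply: sb => //; apply: contraTneq xf => ->.
have := S1_ee stripz fe; rewrite disjoint_sym => /disjointFr-> //.
exact: subsetP (S3_sub stripz _ v) _ (bW i).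
Qed.

Lemma jewel_at_seagull_on e1 e2 x : jewel_at_seagull z a v e1 e2 x ->
  e1 != e2 /\ exists p b q c,
    [/\ jewel_on a zone (fun e => sev z e v) x e1 e2 p b q c,
        reaches e1 p & reaches e2 q].
Proof.
move=> [e12 v1 v2 xz [e3 [e31 e32 v3 [b [Gam [pyr [_ anti nbhd]]]]]]];
  split=> //.
have xo := jewel_outside xz.
pose i0 : 'I_3 := ord0; pose i1 : 'I_3 := inord 1.
have i1E : i1 = 1 :> nat by rewrite inordK.
have [p [Ep hp rp]] := pyramid_arm i0 pyr.
have [q [Eq hq rq]] := pyramid_arm i1 pyr.
have [s [Es hs _]] := pyramid_arm ord_max pyr.
have t0 : tnth [tuple e1; e2; e3] i0 = e1 by [].
have t1 : tnth [tuple e1; e2; e3] i1 = e2 by rewrite (tnth_nth e1) i1E.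
have t2 : tnth [tuple e1; e2; e3] ord_max = e3 by [].
rewrite t0 in hp rp; rewrite t1 in hq rq; rewrite t2 in hs.
exists p, (b i0), q, (b i1); split=> //; split=> //.
- split=> //; apply: attaches_closed_nbhd hp xo _.
  by rewrite -Ep; apply: nbhd.
- split=> //; apply: attaches_closed_nbhd hq xo _.
  by rewrite -Eq; apply: nbhd; rewrite -val_eqE /= i1E.
- exists e3, s, (b ord_max); split; rewrite 1?eq_sym //.
  move=> u us; apply: anti; rewrite ?inE // Es.
  by rewrite us orbT.
Qed.
End StripArms.

(** Both orders of the edges are allowed for [y], so that seagulls can be counted as unordered
    pairs. *)
Lemma jewels_clique (G T : sgraph) (a : G) (z : strip T G) (v : T) e1 e2 x y :
    theta_free G -> prism_free G -> tree T -> strip_structure z a -> rich z a ->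
    jewel_at_seagull z a v e1 e2 x ->
    jewel_at_seagull z a v e1 e2 y \/ jewel_at_seagull z a v e2 e1 y ->
  x != y -> x -- y.
Proof.
move=> thetaG prismG treeT sz rz jx jy.
have [e12 [p [b [q [c [{}jx rp rq]]]]]] := jewel_at_seagull_on sz rz jx.
have {jy}[p2 [b2 [q2 [c2 [jy rp2 rq2]]]]] : exists p2 b2 q2 c2,
    [/\ jewel_on a (zone z v) (fun e => sev z e v) y e1 e2 p2 b2 q2 c2,
      reaches z v e1 p2 & reaches z v e2 q2].
  case: jy => jy; have [_ [p2 [b2 [q2 [c2 [on r1 r2]]]]]] := jewel_at_seagull_on sz rz jy.
    by exists p2, b2, q2, c2.
  by exists q2, c2, p2, b2; split=> //; apply: jewel_on_sym on.
exact: (jewels_adjacent thetaG prismG (@zone_a _ _ _ _ v sz)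
  (@root_sub _ _ _ _ v treeT sz) (@zone_sep _ _ _ _ v treeT sz)
  (@root_complete _ _ _ _ v sz) e12 jx jy
  (reaches_touch sz rz rp rp2) (reaches_touch sz rz rq rq2)).
Qed.

(** * Counting jewels by seagulls *)

Lemma card_edges_at (T : sgraph) (v : T) :
  #|[set e : edge T | v \in val e]| <= degree v.
Proof.
rewrite -(card_imset _ val_inj).
apply: leq_trans (leq_imset_card (fun u => [set v; u]) [set u in setT | v -- u]).
apply: subset_leq_card; apply/subsetP => _ /imsetP[e ve ->].
rewrite inE in ve; have [u vu ->] := edge_end ve.
by apply/imsetP; exists u; rewrite ?inE.
Qed.

Lemma card_jewels (t delta : nat) (G T : sgraph) (a : G) (z : strip T G) (v : T) :
    theta_free G -> prism_free G ->
    (forall K : {set G}, clique K -> #|K| <> t) ->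
    tree T -> max_degree T = delta -> strip_structure z a -> rich z a ->
  #|jewels z a v| <= 'C(delta, 2) * t.-1.
Proof.
move=> thetaG prismG noK treeT dT sz rz.
pose D := [set e : edge T | v \in val e].
pose P := [set E : {set edge T} | (E \subset D) && (#|E| == 2)].
pose J (E : {set edge T}) := [set x | `[< exists e1 e2,
  E = [set e1; e2] /\ jewel_at_seagull z a v e1 e2 x >]].
have JP : jewels z a v \subset \bigcup_(E in P) J E.
  apply/subsetP => x; rewrite inE => /asboolP[e1 [e2 jx]].
  have [e12 v1 v2 _ _] := jx; apply/bigcupP; exists [set e1; e2].
    by rewrite inE subUset !sub1set !inE v1 v2 cards2 e12.
  by rewrite inE; apply/asboolP; exists e1, e2.
have cardJ E : #|J E| <= t.-1.
  have cJ : clique (J E).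
    move=> x y; rewrite !inE => /asboolP[e1 [e2 [-> jx]]] /asboolP[f1 [f2 [ef jy]]].
    apply: (jewels_clique thetaG prismG treeT sz rz jx).
    have [e12 _ _ _ _] := jx; have [f12 _ _ _ _] := jy.
    have := set21 f1 f2; have := set22 f1 f2; rewrite -ef !inE.
    case/orP=> /eqP f2E /orP[] /eqP f1E; move: jy f12; rewrite f1E f2E ?eqxx //.
      by right.
    by left.
  (* A larger clique would contain one of size exactly [t]. *)
  have Kt : #|J E| < t.
    rewrite ltnNge; apply/negP => /(clique_sub cJ)[K cK /noK]; exact.
  by case: t Kt {noK}.
apply: leq_trans (subset_leq_card JP) _.
apply: leq_trans (card_bigcup_le (fun E _ => cardJ E)) _.
rewrite leq_mul2r; apply/orP; right.
rewrite (_ : #|_| = #|P|) // cards_draws; apply: leq_bin2l.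
apply: leq_trans (card_edges_at v) _.
by rewrite -dT; apply: leq_bigmax.
Qed.

Theorem theorem5p4 (t delta : nat) (ht : 0 < t) (hdelta : 0 < delta) :
  (exists j : nat, 0 < j /\ jewel_bound t delta j) /\
  (exists r : nat, is_ramsey_number t 3 r /\
     jewel_bound t delta ('C(delta, 2) * r)).
Proof.
have [r ramr] := ramsey_number3 t.
suff bound : jewel_bound t delta ('C(delta, 2) * r).
  split; last by exists r.
  (* The successor makes [j] positive even when the binomial coefficient vanishes, as for
     [delta = 1]. *)
  exists ('C(delta, 2) * r).+1; split=> // G a T z v *.
  by apply: ltnW; apply: bound; eassumption.
move=> G a T z v thetaG prismG noK treeT smT dT sz rz.
apply: leq_ltn_trans (card_jewels v thetaG prismG noK treeT dT sz rz) _.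
have C0 : 0 < 'C(delta, 2) by rewrite bin_gt0 -dT smooth_max_degree.
(* After cancelling the positive factor, [t.-1 < r] remains, which holds since [t <= r]. *)
by rewrite ltn_pmul2l // -ltnS prednK // ltnS ramsey_ge //; case: ramr.
Qed.
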